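(* Let $\theta_0^n\in\mathbb{R}^n$ be a sequence of vectors, and let $p_n$ be the number of nonzero coordinates of $\theta_0^n$, where $1\le p_n<n$. Let $\alpha>1$. Assume that each density $g_S$ is the product of $|S|$ copies of the univariate probability density proportional to $y\mapsto e^{-|y|^\alpha}$, and that the prior $\pi_n$ on dimension satisfies, for some constants $c>0$ and $K>0$ not depending on $n$, $\pi_n(p_n)\ge K\exp(-cp_n\log(n/p_n))$. (i) If $\alpha\ge2$ and $\|\theta_0^n\|^2/(p_n\log(n/p_n))\to\infty$, then for sufficiently small $\eta>0$, as $n\to\infty$, $$P_{n,\theta_0^n}\,\Pi_n\bigl(\theta:\|\theta-\theta_0^n\|\le\eta\|\theta_0^n\|\mid X\bigr)\to0 .$$ (ii) If $1<\alpha<2$ and $(\rho_{0,\alpha}^n)^2/(p_n\log(n/p_n))\to\infty$, where $$\rho_{0,\alpha}^n=\Bigl(\frac{\|\theta_0^n\|_\alpha^\alpha}{\|\theta_0^n\|^2}\wedge1\Bigr)\|\theta_0^n\|_\alpha\,p_n^{1/2-1/\alpha},$$ then for sufficiently small $\eta>0$, as $n\to\infty$, $$P_{n,\theta_0^n}\,\Pi_n\bigl(\theta:\|\theta-\theta_0^n\|\le\eta\rho_{0,\alpha}^n\mid X\bigr)\to0 .$$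
   Context: For $\theta\in\mathbb{R}^n$, $P_{n,\theta}$ denotes the $N_n(\theta,I)$ distribution of $X=(X_1,\dots,X_n)$, with Lebesgue density $p_{n,\theta}$, and $P_{n,\theta}T$ denotes the expectation of $T=T(X)$ under it. $\|\cdot\|$ is the Euclidean norm, $\|\theta\|_\alpha=(\sum_i|\theta_i|^\alpha)^{1/\alpha}$, and $a\wedge b=\min(a,b)$. Prior $\Pi_n$ on $\mathbb{R}^n$: (P1) a dimension $p$ is drawn from a probability measure $\pi_n$ on $\{0,1,\dots,n\}$ with $\pi_n(p)>0$ for every $p$; (P2) given $p$, a subset $S\subset\{1,\dots,n\}$ with $|S|=p$ is drawn uniformly from the $\binom np$ subsets of size $p$; (P3) given $(p,S)$, the vector $\theta_S=(\theta_i:i\in S)$ is drawn from a probability density $g_S$ on $\mathbb{R}^S$ (if $p\ge1$), and the coordinates $\theta_i$, $i\notin S$, are set equal to $0$. Posterior: $\Pi_n(B\mid X)=\int_B p_{n,\theta}(X)\,d\Pi_n(\theta)\big/\int p_{n,\theta}(X)\,d\Pi_n(\theta)$ for Borel $B\subset\mathbb{R}^n$. *)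

(* Defs.v *)
From HB Require Import structures.
From mathcomp Require Import all_boot all_order all_algebra.
From mathcomp Require Import all_classical all_reals all_analysis.
From mathcomp Require Import measurable_realfun.

Set Implicit Arguments.
Unset Strict Implicit.
Unset Printing Implicit Defensive.

Import Order.TTheory GRing.Theory Num.Theory.
Import numFieldNormedType.Exports.

Local Open Scope classical_set_scope.
Local Open Scope ring_scope.

Definition l2norm (R : realType) (n : nat) (v : 'I_n -> R) : R :=
  Num.sqrt (\sum_(i < n) v i ^+ 2).

Definition lpnorm (R : realType) (n : nat) (a : R) (v : 'I_n -> R) : R :=
  (\sum_(i < n) `|v i| `^ a) `^ a^-1.

Section sparsity.
Context {R : realType} {n : nat}.
Implicit Type theta : n.-tuple R.

Lemma nnz_subproof theta : (#|[pred i | tnth theta i != 0%R]| < n.+1)%N.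
Proof. by rewrite ltnS -[leqRHS]card_ord max_card. Qed.

Definition nnz theta : 'I_n.+1 := Ordinal (nnz_subproof theta).

Definition sparse_rate theta : R :=
  (nnz theta)%:R * ln (n%:R / (nnz theta)%:R).

Definition rho_radius (a : R) theta : R :=
  Num.min (lpnorm a (tnth theta) `^ a / l2norm (tnth theta) ^+ 2) 1 *
  lpnorm a (tnth theta) * (nnz theta)%:R `^ (2^-1 - a^-1).

End sparsity.

Definition exp_power_pdf (R : realType) (a y : R) : R :=
  expR (- (`|y| `^ a)) / \int[lebesgue_measure]_z expR (- (`|z| `^ a)).

Section lebesgue_tuple.
Context {R : realType}.

Definition tcons n (u : measurableTypeR R * n.-tuple R) : n.+1.-tuple R :=
  [the n.+1.-tuple R of (u.1 : R) :: u.2].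

Definition tuncons n (t : n.+1.-tuple R) : measurableTypeR R * n.-tuple R :=
  (thead t, [tuple of behead t]).

Lemma tconsK n : cancel (@tcons n) (@tuncons n).
Proof. by move=> [x t]; congr (_, _); apply: val_inj. Qed.

Lemma tunconsK n : cancel (@tuncons n) (@tcons n).
Proof. by move=> t; rewrite [RHS]tuple_eta; exact: val_inj. Qed.

Lemma measurable_tcons n : measurable_fun [set: _] (@tcons n).
Proof. exact: measurable_cons. Qed.

Lemma measurable_tuncons n : measurable_fun [set: _] (@tuncons n).
Proof.
apply/measurable_fun_pairP; split; first exact: measurable_tnth.
exact: measurable_behead.
Qed.

Definition lebesgue_consm n
    (m : {sigma_finite_measure set (n.-tuple R) -> \bar R}) :
    set (n.+1.-tuple R) -> \bar R :=
  pushforward (lebesgue_measure \x m)%E (@tcons n).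

Section lebesgue_consm.
Local Open Scope ereal_scope.
Variables (n : nat) (m : {sigma_finite_measure set (n.-tuple R) -> \bar R}).

Let pm : {measure set (measurableTypeR R * n.-tuple R)%type -> \bar R} :=
  (lebesgue_measure \x m).

Let m0 : lebesgue_consm m set0 = 0.
Proof. by rewrite /lebesgue_consm /pushforward preimage_set0 (measure0 pm). Qed.

Let m_ge0 A : 0 <= lebesgue_consm m A.
Proof. exact: (measure_ge0 pm). Qed.

Let m_sigma_additive : semi_sigma_additive (lebesgue_consm m).
Proof.
exact: (@measure_semi_sigma_additive _ _ _
  (measure_function_pushforward__canonical__measure_function_Measure pm
    (@measurable_tcons n))).
Qed.

HB.instance Definition _ := isMeasure.Build _ _ _ (lebesgue_consm m)
  m0 m_ge0 m_sigma_additive.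

Let m_sigma_finite : sigma_finite setT (lebesgue_consm m).
Proof.
have /sigma_finiteP[F [TF ndF Foo]] :=
  sigma_finiteT (@lebesgue_measure R : {sigma_finite_measure set _ -> \bar R}).
have /sigma_finiteP[G [TG ndG Goo]] := sigma_finiteT m.
exists (fun k => @tuncons n @^-1` (F k `*` G k)).
  rewrite -preimage_bigcup predeqE => t; split => // _ /=.
  have [i _ Fi] : (\bigcup_i F i) (tuncons t).1 by rewrite -TF.
  have [j _ Gj] : (\bigcup_i G i) (tuncons t).2 by rewrite -TG.
  exists (maxn i j) => //; split.
  - by move: Fi; exact/subsetPset/ndF/leq_maxl.
  - by move: Gj; exact/subsetPset/ndG/leq_maxr.
move=> k; have [mF Fk] := Foo k; have [mG Gk] := Goo k; split.
  rewrite -[X in measurable X]setTI.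
  by apply: measurable_tuncons => //; exact: measurableX.
rewrite /lebesgue_consm /pushforward -comp_preimage.
rewrite (_ : @tuncons n \o @tcons n = id); last by apply/funext => x; exact: tconsK.
by rewrite preimage_id product_measure1E// lte_mul_pinfty// ge0_fin_numE.
Qed.

HB.instance Definition _ := Measure_isSigmaFinite.Build _ _ _
  (lebesgue_consm m) m_sigma_finite.

End lebesgue_consm.

(* Lebesgue measure on R^n, as the iterated product of the one-dimensional one
   (on R^0 it is the Dirac mass at the empty tuple). *)
Fixpoint lebesgue_tuple n : {sigma_finite_measure set (n.-tuple R) -> \bar R} :=
  match n with
  | 0 => \d_[tuple]
  | k.+1 => lebesgue_consm (lebesgue_tuple k)
  end.

Lemma ge0_integral_lebesgue_tupleS n (f : n.+1.-tuple R -> \bar R) :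
  measurable_fun [set: n.+1.-tuple R] f -> (forall t, 0 <= f t)%E ->
  (\int[lebesgue_tuple n.+1]_t f t =
   \int[lebesgue_measure]_x \int[lebesgue_tuple n]_t f (tcons (x, t)))%E.
Proof.
move=> mf f0.
rewrite ge0_integral_pushforward//=; last exact: measurable_tcons.
rewrite preimage_setT.
rewrite (@fubini_tonelli1 _ _ _ _ _ _ _ (f \o @tcons n))//; last first.
  by move=> x; exact: f0.
by apply: measurableT_comp => //; exact: measurable_tcons.
Qed.

End lebesgue_tuple.

(* Probability densities with respect to Lebesgue measure on R^n. *)
Record density (R : realType) (n : nat) := Density {
  dens :> n.-tuple R -> R ;
  dens_ge0 : forall x, 0 <= dens x ;
  measurable_dens : measurable_fun [set: n.-tuple R] dens ;
  integral_dens : (\int[lebesgue_tuple n]_x (dens x)%:E = 1)%E }.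

Section density_prob.
Local Open Scope ereal_scope.
Context {R : realType} {n : nat}.
Variable f : density R n.

Definition density_prob (A : set (n.-tuple R)) : \bar R :=
  \int[lebesgue_tuple n]_(x in A) (f x)%:E.

Let density_prob0 : density_prob set0 = 0.
Proof. exact: integral_set0. Qed.

Let density_prob_ge0 A : 0 <= density_prob A.
Proof. by apply: integral_ge0 => x _; rewrite lee_fin dens_ge0. Qed.

Let density_prob_sigma_additive : semi_sigma_additive density_prob.
Proof.
move=> /= F mF tF mUF; rewrite /density_prob ge0_integral_bigcup//=.
- apply: is_cvg_ereal_nneg_natsum_cond => k _ _.
  exact: density_prob_ge0.
- by apply/measurable_EFinP; apply: measurable_funTS; exact: measurable_dens.
- by move=> x _; rewrite lee_fin dens_ge0.
Qed.

HB.instance Definition _ := isMeasure.Build _ _ _ density_prob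
  density_prob0 density_prob_ge0 density_prob_sigma_additive.

HB.instance Definition _ := Measure_isProbability.Build _ _ _ density_prob
  (integral_dens f).

End density_prob.

Section gaussian.
Context {R : realType}.

Definition gauss_pdf n (theta x : n.-tuple R) : R :=
  \prod_(i < n) normal_pdf (tnth theta i) 1 (tnth x i).

Lemma gauss_pdf_ge0 n (theta x : n.-tuple R) : 0 <= gauss_pdf theta x.
Proof. by apply: prodr_ge0 => i _; exact: normal_pdf_ge0. Qed.

Lemma measurable_gauss_pdf n (theta : n.-tuple R) :
  measurable_fun [set: n.-tuple R] (gauss_pdf theta).
Proof.
apply: measurable_prod => i _.
apply: (measurableT_comp (measurable_normal_pdf _ _)).
exact: measurable_tnth.
Qed.

Lemma integral_gauss_pdf n (theta : n.-tuple R) :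
  (\int[lebesgue_tuple n]_x (gauss_pdf theta x)%:E = 1)%E.
Proof.
elim: n theta => [|n IH] theta.
  rewrite integral_dirac//=; last first.
    by apply/measurable_EFinP; exact: measurable_gauss_pdf.
  by rewrite diracT mul1e /gauss_pdf big_ord0.
rewrite ge0_integral_lebesgue_tupleS; first last.
- by move=> t; rewrite lee_fin gauss_pdf_ge0.
- by apply/measurable_EFinP; exact: measurable_gauss_pdf.
rewrite -(integral_normal_pdf (thead theta) 1); apply: eq_integral => x _.
rewrite -[RHS]mule1 -(IH [tuple of behead theta]) -ge0_integralZl//=.
- apply: eq_integral => t _; rewrite -EFinM; congr EFin.
  rewrite /gauss_pdf big_ord_recl; congr (_ * _).
  by apply: eq_bigr => i _; rewrite [in LHS](tuple_eta theta) !tnthS.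
- by apply/measurable_EFinP; exact: measurable_gauss_pdf.
- by move=> t _; rewrite lee_fin gauss_pdf_ge0.
- by rewrite lee_fin normal_pdf_ge0.
Qed.

Definition gauss_density n (theta : n.-tuple R) : density R n :=
  Density (@gauss_pdf_ge0 n theta) (@measurable_gauss_pdf n theta)
    (@integral_gauss_pdf n theta).

(* N_n(theta, I) *)
Definition mvnormal n (theta : n.-tuple R) : probability (n.-tuple R) R :=
  density_prob (gauss_density theta).

End gaussian.

Record fin_pmf (R : realType) (I : finType) := FinPmf {
  pmass :> I -> R ;
  pmass_ge0 : forall i, 0 <= pmass i ;
  pmass_sum1 : \sum_(i : I) pmass i = 1 }.

(* The law obtained by drawing i from w, and then a point from m i. *)
Section mixture.
Local Open Scope ereal_scope.
Context d (T : measurableType d) (R : realType) (I : finType).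
Variables (w : fin_pmf R I) (m : I -> probability T R).

Definition mixture (A : set T) : \bar R := \sum_(i : I) (w i)%:E * m i A.

Let mixture0 : mixture set0 = 0.
Proof. by apply: big1 => i _; rewrite measure0 mule0. Qed.

Let mixture_ge0 A : 0 <= mixture A.
Proof. by apply: sume_ge0 => i _; rewrite mule_ge0// lee_fin pmass_ge0. Qed.

Let mixture_sigma_additive : semi_sigma_additive mixture.
Proof.
move=> F mF tF mUF; rewrite [X in _ --> X](_ : _ =
    lim ((fun n => \sum_(0 <= i < n) mixture (F i)) @ \oo)).
  by apply: is_cvg_ereal_nneg_natsum => k _; exact: mixture_ge0.
rewrite nneseries_sum; last first.
  by move=> i j _; rewrite mule_ge0// lee_fin pmass_ge0.
apply: eq_bigr => i _; rewrite nneseriesZl//.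
by congr (_ * _); exact: measure_semi_bigcup.
Qed.

HB.instance Definition _ := isMeasure.Build _ _ _ mixture
  mixture0 mixture_ge0 mixture_sigma_additive.

Let mixtureT : mixture setT = 1.
Proof.
rewrite /mixture; under eq_bigr do rewrite probability_setT mule1.
by rewrite sumEFin pmass_sum1.
Qed.

HB.instance Definition _ := Measure_isProbability.Build _ _ _ mixture mixtureT.

End mixture.

Section prior.
Context {R : realType} {n : nat}.

(* The uniform law on the subsets of size p. *)
Section subset_pmf.
Variable p : 'I_n.+1.

Let unif (S : {set 'I_n}) : R := (#|S| == p)%:R / 'C(n, p)%:R.

Let unif_ge0 S : 0 <= unif S.
Proof. by rewrite divr_ge0. Qed.

Let unif_sum1 : \sum_(S : {set 'I_n}) unif S = 1.
Proof.
rewrite -mulr_suml -natr_sum -big_mkcond/= sum1dep_card card_draws card_ord.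
by rewrite divff// pnatr_eq0 -lt0n bin_gt0 -ltnS.
Qed.

Definition subset_pmf : fin_pmf R {set 'I_n} := FinPmf unif_ge0 unif_sum1.

End subset_pmf.

(* The coordinates of y are those of theta_S in increasing order of the indices
   in S. For i \notin S, index i (enum S) = #|S| is out of range, so that the
   i-th coordinate is the default value 0. *)
Definition coord_embed (S : {set 'I_n}) (y : #|S|.-tuple R) : n.-tuple R :=
  [tuple nth 0 y (index i (enum S)) | i < n].

Lemma measurable_coord_embed (S : {set 'I_n}) :
  measurable_fun [set: _] (@coord_embed S).
Proof.
apply/measurable_fun_tnthP => i.
rewrite (_ : _ \o _ = fun y : #|S|.-tuple R => nth 0 y (index i (enum S))).
  have [iS|iS] := ltnP (index i (enum S)) #|S|.
    rewrite (_ : (fun _ => _) = @tnth _ R ^~ (Ordinal iS)).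
      exact: measurable_tnth.
    by apply/funext => y; rewrite (tnth_nth 0).
  rewrite (_ : (fun _ => _) = cst 0); first exact: measurable_cst.
  by apply/funext => y; rewrite nth_default// size_tuple.
by apply/funext => y /=; rewrite tnth_mktuple.
Qed.

Definition subset_prior (g : forall S : {set 'I_n}, density R #|S|)
    (S : {set 'I_n}) : set (n.-tuple R) -> \bar R :=
  pushforward (density_prob (g S)) (@coord_embed S).

Section subset_prior.
Local Open Scope ereal_scope.
Variables (g : forall S : {set 'I_n}, density R #|S|) (S : {set 'I_n}).

Let p0 : subset_prior g S set0 = 0.
Proof. by rewrite /subset_prior /pushforward preimage_set0 measure0. Qed.

Let p_ge0 A : 0 <= subset_prior g S A.
Proof. exact: (measure_ge0 (density_prob (g S))). Qed.

Let p_sigma_additive : semi_sigma_additive (subset_prior g S).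
Proof.
exact: (@measure_semi_sigma_additive _ _ _
  (measure_function_pushforward__canonical__measure_function_Measure
    (density_prob (g S)) (@measurable_coord_embed S))).
Qed.

HB.instance Definition _ := isMeasure.Build _ _ _ (subset_prior g S)
  p0 p_ge0 p_sigma_additive.

Let pT : subset_prior g S setT = 1.
Proof. by rewrite /subset_prior /pushforward preimage_setT probability_setT. Qed.

HB.instance Definition _ :=
  Measure_isProbability.Build _ _ _ (subset_prior g S) pT.

End subset_prior.

Definition prior (w : fin_pmf R 'I_n.+1)
    (g : forall S : {set 'I_n}, density R #|S|) : probability (n.-tuple R) R :=
  mixture w (fun p => mixture (subset_pmf p) (subset_prior g)).

Definition posterior (Pi : probability (n.-tuple R) R) (x : n.-tuple R)
    (B : set (n.-tuple R)) : R :=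
  (\int[Pi]_(t in B) gauss_pdf t x) / (\int[Pi]_t gauss_pdf t x).

End prior.

(* Main.v *)
(* Given the support S, prior and posterior are products over the coordinates.
   Bounding the indicator of the ball of radius r around theta0 by
   [expR (lam * r ^+ 2) * \prod_i expR (- lam * (theta_i - theta0_i) ^+ 2)], the
   posterior of the ball given S is at most [expR (lam * r ^+ 2)] times a product
   of one-dimensional posterior means, where a coordinate outside S contributes
   [expR (- lam * theta0_i ^+ 2)]. Dominating the factor of coordinate i in both
   cases by a single function F_i of X_i makes the bound independent of S, hence
   of the prior on dimensions, and its expectation factorizes. The prior shrinks
   a coordinate with mean a by the order of
   [s(a) = min `|a| (`|a| `^ min 1 (alpha - 1))], which yields
   [E F_i <= expR (- c * s(theta0_i) ^+ 2)], so the expected posterior is at most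
   [expR (lam * r ^+ 2 - c * \sum_i s(theta0_i) ^+ 2)]. The sum is
   [l2norm theta0 ^+ 2] if alpha >= 2 and at least [rho_radius theta0 ^+ 2 / 16] if
   alpha < 2; both tend to infinity because the sparse rate is at least 1/2. *)

Require Import Defs.
From HB Require Import structures.
From mathcomp Require Import all_boot all_order all_algebra.
From mathcomp Require Import all_classical all_reals all_analysis.
From mathcomp Require Import measurable_realfun.
From mathcomp Require Import ring lra.

Set Implicit Arguments.
Unset Strict Implicit.
Unset Printing Implicit Defensive.

Import Order.TTheory GRing.Theory Num.Theory.
Import numFieldNormedType.Exports.

Local Open Scope classical_set_scope.
Local Open Scope ring_scope.

(** * Integration against densities and mixtures *)

Section integration.
Local Open Scope ereal_scope.

Import HBNNSimple.

(* Monotone even for nonmeasurable functions, the integral of a nonnegative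
   function being a supremum over the simple functions below it. *)
Lemma ge0_le_integralT d (T : measurableType d) (R : realType)
    (mu : {measure set T -> \bar R}) (f g : T -> \bar R) :
  (forall x, 0 <= f x) -> (forall x, f x <= g x) ->
  \int[mu]_x f x <= \int[mu]_x g x.
Proof.
move=> f0 fg; have g0 x : 0 <= g x by rewrite (le_trans (f0 x)).
rewrite !ge0_integralTE//; apply: ereal_sup_le => _ [h hf <-].
by exists h => // x; rewrite (le_trans (hf x)).
Qed.

(** The identity holds for simple functions by linearity; both sides pass to the limit along
    [nnsfun_approx] by monotone convergence. *)
Lemma ge0_integral_density_prob (R : realType) n (f : density R n)
    (g : n.-tuple R -> \bar R) :
  measurable_fun setT g -> (forall x, 0 <= g x) ->
  \int[density_prob f]_x g x = \int[lebesgue_tuple n]_x (g x * (f x)%:E).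
Proof.
move=> mg g0.
have mf : measurable_fun setT (EFin \o f).
  by apply/measurable_EFinP; exact: measurable_dens.
have f0 x : 0 <= (f x)%:E by rewrite lee_fin dens_ge0.
have dpE (h : {nnsfun (n.-tuple R) >-> R}) :
    \int[density_prob f]_x (h x)%:E
    = \int[lebesgue_tuple n]_x ((h x)%:E * (f x)%:E).
  under eq_integral do rewrite fimfunE -fsumEFin//.
  rewrite ge0_integral_fsum//; last 2 first.
    - by move=> r; exact/measurable_EFinP/measurableT_comp.
    - by move=> r x _; rewrite EFinM nnfun_muleindic_ge0.
  under [RHS]eq_integral.
    move=> x _; rewrite fimfunE -fsumEFin// ge0_mule_fsuml; last first.
      by move=> r; rewrite EFinM nnfun_muleindic_ge0.
    over.
  rewrite [RHS]ge0_integral_fsum//; last 2 first.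
    - by move=> r; apply: emeasurable_funM => //;
        apply/measurable_EFinP/measurableT_comp.
    - by move=> r x _; rewrite mule_ge0// EFinM nnfun_muleindic_ge0.
  apply: eq_fsbigr => r _.
  rewrite integralZl_indic_nnsfun// integral_indic// setIT.
  under [RHS]eq_integral do rewrite EFinM -muleA.
  have [r0|r0] := leP 0%R r.
    rewrite [RHS]ge0_integralZl//; last 2 first.
      - by apply: emeasurable_funM => //; apply/measurable_EFinP.
      - by move=> x _; rewrite mule_ge0// lee_fin.
    congr (_ * _).
    transitivity (\int[lebesgue_tuple n]_(x in h @^-1` [set r]) (f x)%:E) => //.
    rewrite [LHS]integral_mkcond; apply: eq_integral => x _; rewrite /patch indicE.
    by case: ifPn => xE; rewrite ?mul1e ?mul0e.
  rewrite preimage_nnfun0// measure0 mule0; apply/esym.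
  by apply: integral0_eq => x _; rewrite indic0 mul0e mule0.
pose h := nnsfun_approx measurableT mg.
transitivity (limn (fun k => \int[density_prob f]_x (h k x)%:E)).
  rewrite -monotone_convergence//=.
  - apply: eq_integral => x _; apply/esym/cvg_lim => //=.
    exact: cvg_nnsfun_approx.
  - by move=> k; exact/measurable_EFinP/measurable_funTS.
  - by move=> k x _; rewrite lee_fin.
  - by move=> x _ k l kl; rewrite lee_fin; exact/lefP/nd_nnsfun_approx.
under eq_fun do rewrite dpE.
rewrite -monotone_convergence//=.
- apply: eq_integral => x _; apply/cvg_lim => //=.
  apply: cvgeZr => //; exact: cvg_nnsfun_approx.
- move=> k; apply: emeasurable_funM => //.
  exact/measurable_EFinP/measurable_funTS.
- by move=> k x _; rewrite mule_ge0// lee_fin.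
- move=> x _ k l kl; rewrite lee_wpmul2r// lee_fin.
  exact/lefP/nd_nnsfun_approx.
Qed.

Lemma ge0_integral_mixture d (T : measurableType d) (R : realType)
    (I : finType) (w : fin_pmf R I) (m : I -> probability T R)
    (f : T -> \bar R) :
  measurable_fun setT f -> (forall x, 0 <= f x) ->
  \int[mixture w m]_x f x = \sum_(i : I) (w i)%:E * \int[m i]_x f x.
Proof.
move=> mf f0.
pose W i : {nonneg R} := NngNum (pmass_ge0 w i).
(* The mixture is the finite sum of the scaled components, listed along an enumeration of [I].
   Indices from [#|I|] on get the zero measure and never enter the sum. *)
pose m_ (k : nat) : {measure set T -> \bar R} :=
  if insub k is Some j
  then let i := enum_val (j : 'I_#|I|) in
    [the {measure set T -> \bar R} of mscale (W i) (m i)]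
  else [the {measure set T -> \bar R} of mzero].
have m_E (i : 'I_#|I|) :
    m_ i = [the {measure set T -> \bar R}
      of mscale (W (enum_val i)) (m (enum_val i))].
  rewrite /m_; case: insubP => [j _ /val_inj->//|]; by rewrite ltn_ord.
have sumE (F : I -> \bar R) : \sum_(i : I) F i = \sum_(k < #|I|) F (enum_val k).
  by rewrite -big_enum_val.
transitivity (\int[msum m_ #|I|]_x f x).
  apply: eq_measure_integral => A mA _.
  transitivity (\sum_(i : I) (w i)%:E * m i A) => //.
  by rewrite sumE; apply: eq_bigr => i _; rewrite m_E.
rewrite ge0_integral_measure_sum//.
rewrite sumE.
by apply: eq_bigr => i _; rewrite m_E ge0_integral_mscale.
Qed.

(** A ratio bound that is uniform over the components survives mixing, whatever the weights. This is
    how the prior on dimensions and supports drops out. *)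
Lemma le_integral_mixture d (T : measurableType d) (R : realType)
    (I : finType) (w : fin_pmf R I) (m : I -> probability T R)
    (f g : T -> \bar R) (C : R) :
  measurable_fun setT f -> (forall x, 0 <= f x) ->
  measurable_fun setT g -> (forall x, 0 <= g x) ->
  (forall i, \int[m i]_x f x <= C%:E * \int[m i]_x g x) ->
  \int[mixture w m]_x f x <= C%:E * \int[mixture w m]_x g x.
Proof.
move=> mf f0 mg g0 fg; rewrite !ge0_integral_mixture// ge0_sume_distrr; last first.
  by move=> i _; rewrite mule_ge0 ?lee_fin ?pmass_ge0// integral_ge0.
by apply: lee_sum => i _; rewrite muleCA lee_wpmul2l// lee_fin pmass_ge0.
Qed.

End integration.

(** * Product integrals and the posterior of a ball *)

Section product_integrals.
Context {R : realType}.

Lemma normal_pdfC (m y : R) : normal_pdf m 1 y = normal_pdf y 1 m.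
Proof. by rewrite /normal_pdf oner_eq0 /normal_fun -(sqrrN (y - m)) opprB. Qed.

Lemma measurable_normal_pdf_mean (x : R) :
  measurable_fun setT (fun y : R => normal_pdf y 1 x).
Proof.
rewrite (_ : (fun y : R => normal_pdf y 1 x) = normal_pdf x 1).
  exact: measurable_normal_pdf.
by apply/funext => y; rewrite normal_pdfC.
Qed.

Lemma measurable_expR_sqr (lam a : R) :
  measurable_fun setT (fun y : R => expR (- (lam * (y - a) ^+ 2))).
Proof.
apply: measurableT_comp => //; apply: measurableT_comp => //.
by apply: measurable_funM => //; apply: measurable_funX; exact: measurable_funB.
Qed.

Lemma measurable_prod_tnth n (f : 'I_n -> R -> R) :
  (forall i, measurable_fun setT (f i)) ->
  measurable_fun setT (fun t : n.-tuple R => \prod_(i < n) f i (tnth t i)).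
Proof.
move=> mf; apply: measurable_prod => i _.
by apply: (measurableT_comp (mf i)); exact: measurable_tnth.
Qed.

Lemma ge0_integral_prod_tuple n (f : 'I_n -> R -> R) (c : 'I_n -> R) :
  (forall i, measurable_fun setT (f i)) -> (forall i y, 0 <= f i y) ->
  (forall i, \int[lebesgue_measure]_y (f i y)%:E = (c i)%:E)%E ->
  (\int[lebesgue_tuple n]_t (\prod_(i < n) f i (tnth t i))%:E =
   (\prod_(i < n) c i)%:E)%E.
Proof.
elim: n f c => [|n IH] f c mf f0 fc.
  rewrite integral_dirac//=; last first.
    by apply/measurable_EFinP; exact: measurable_prod_tnth.
  by rewrite diracT mul1e !big_ord0.
have f'0 (t : n.-tuple R) : 0 <= \prod_(i < n) f (lift ord0 i) (tnth t i).
  exact: prodr_ge0.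
rewrite ge0_integral_lebesgue_tupleS; first last.
- by move=> t; rewrite lee_fin; exact: prodr_ge0.
- by apply/measurable_EFinP; exact: measurable_prod_tnth.
transitivity (\int[lebesgue_measure]_x
    ((f ord0 x)%:E * (\prod_(i < n) c (lift ord0 i))%:E))%E.
  apply: eq_integral => x _.
  rewrite -(IH (fun i => f (lift ord0 i)))// -ge0_integralZl//=.
  - apply: eq_integral => t _; rewrite -EFinM big_ord_recl; congr (_ * _)%:E.
    by apply: eq_bigr => i _; rewrite tnthS.
  - apply/measurable_EFinP.
    exact: (@measurable_prod_tnth _ (fun i => f (lift ord0 i))).
  - by move=> t _; rewrite lee_fin.
  - by rewrite lee_fin.
have c0 i : 0 <= c i.
  by rewrite -lee_fin -fc; apply: integral_ge0 => y _; rewrite lee_fin.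
rewrite ge0_integralZr//=.
- by rewrite fc -EFinM big_ord_recl.
- by apply/measurable_EFinP; exact: mf.
- by move=> x _; rewrite lee_fin.
- by rewrite lee_fin; exact: prodr_ge0.
Qed.

(** Given S, the coordinates in S are independent with density [h], and the others sit at 0 and
    contribute the constants [u i 0]. *)
Lemma integral_subset_prior n (g : forall S : {set 'I_n}, density R #|S|)
    (h : R -> R) (S : {set 'I_n}) (u : 'I_n -> R -> R) (c : 'I_n -> R) :
  (forall y, g S y = \prod_(i < #|S|) h (tnth y i)) ->
  measurable_fun setT h -> (forall y, 0 <= h y) ->
  (forall i, measurable_fun setT (u i)) -> (forall i y, 0 <= u i y) ->
  (forall i, \int[lebesgue_measure]_y (u i y * h y)%:E = (c i)%:E)%E ->
  (\int[subset_prior g S]_t (\prod_(i < n) u i (tnth t i))%:E =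
   (\prod_(i < n) if i \in S then c i else u i 0)%:E)%E.
Proof.
move=> gE mh h0 mu u0 uc.
have mU := measurable_prod_tnth mu.
rewrite ge0_integral_pushforward//=; first last.
- by move=> t _; rewrite lee_fin; exact: prodr_ge0.
- by apply/measurable_EFinP; exact: mU.
- exact: measurable_coord_embed.
rewrite preimage_setT ge0_integral_density_prob/=; first last.
- by move=> t; rewrite lee_fin; exact: prodr_ge0.
- by apply/measurable_EFinP/(measurableT_comp mU); exact: measurable_coord_embed.
pose cS := \prod_(i in ~: S) u i 0.
transitivity (\int[lebesgue_tuple #|S|]_y
   (cS%:E * (\prod_(j < #|S|) (u (enum_val j) (tnth y j) * h (tnth y j)))%:E))%E.
  apply: eq_integral => y _; rewrite gE -!EFinM; congr EFin.
  rewrite big_split/= mulrA; congr (_ * _).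
  rewrite (bigID (mem S))/= mulrC; congr (_ * _).
    rewrite /cS; apply: eq_big => i; first by rewrite inE.
    (* Outside S the index in [enum S] is out of range, so [nth] returns its default 0. *)
    move=> iS; rewrite tnth_mktuple nth_default// size_tuple cardE leqNgt.
    by rewrite index_mem mem_enum.
  rewrite (big_enum_val (fun i => u i (tnth (coord_embed y) i))).
  apply: eq_bigr => j _; rewrite tnth_mktuple (tnth_nth 0).
  by rewrite {2}(enum_val_nth (enum_val j)) index_uniq ?enum_uniq// -cardE.
rewrite ge0_integralZl//=.
- rewrite (@ge0_integral_prod_tuple _ (fun j y => u (enum_val j) y * h y)
    (fun j => c (enum_val j)))//; last 2 first.
  + by move=> i; exact: measurable_funM.
  + by move=> i y; exact: mulr_ge0.
  rewrite -EFinM; congr EFin; rewrite [RHS](bigID (mem S))/= mulrC; congr (_ * _).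
    rewrite -(big_enum_val c); apply: eq_bigr => i ->//.
  by rewrite /cS; apply: eq_big => [i|i]; rewrite inE// => /negbTE ->.
- apply/measurable_EFinP.
  apply: (@measurable_prod_tnth _ (fun j y => u (enum_val j) y * h y)) => i.
  exact: measurable_funM.
- by move=> y _; rewrite lee_fin; apply: prodr_ge0 => i _; exact: mulr_ge0.
- by rewrite lee_fin; exact: prodr_ge0.
Qed.


(* [N i / D i] is the factor of coordinate i when i belongs to S; otherwise
   theta_i = 0 and the factor is [expR (- (lam * a_i ^+ 2))]. *)
Lemma posterior_ball_le n (w : fin_pmf R 'I_n.+1)
    (g : forall S : {set 'I_n}, density R #|S|) (h : R -> R)
    (a x : n.-tuple R) (lam r : R) (N D F : 'I_n -> R) :
  (forall S y, g S y = \prod_(i < #|S|) h (tnth y i)) ->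
  measurable_fun setT h -> (forall y, 0 <= h y) -> 0 <= lam -> 0 <= r ->
  (forall i, \int[lebesgue_measure]_y
     (expR (- (lam * (y - tnth a i) ^+ 2)) * normal_pdf y 1 (tnth x i) * h y)%:E
     = (N i)%:E)%E ->
  (forall i, \int[lebesgue_measure]_y
     (normal_pdf y 1 (tnth x i) * h y)%:E = (D i)%:E)%E ->
  (forall i, N i <= F i * D i) ->
  (forall i, expR (- (lam * tnth a i ^+ 2)) <= F i) ->
  posterior (prior w g) x
    [set t : n.-tuple R | l2norm (fun i => tnth t i - tnth a i) <= r]
  <= expR (lam * r ^+ 2) * \prod_(i < n) F i.
Proof.
move=> gE mh h0 lam0 r0 NE DE ND aF.
set B := [set t | _].
have phi0 (y z : R) : 0 <= normal_pdf y 1 z by exact: normal_pdf_ge0.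
have mphi := @measurable_normal_pdf_mean.
pose k i y := expR (- (lam * (y - tnth a i) ^+ 2)).
have mk i : measurable_fun setT (k i) by exact: measurable_expR_sqr.
pose u i y := k i y * normal_pdf y 1 (tnth x i).
have mu i : measurable_fun setT (u i) by exact: measurable_funM.
have u0 i y : 0 <= u i y by rewrite mulr_ge0// expR_ge0.
have F0 i : 0 <= F i by rewrite (le_trans _ (aF i))// expR_ge0.
pose C := expR (lam * r ^+ 2) * \prod_(i < n) F i.
have C0 : 0 <= C by rewrite mulr_ge0 ?expR_ge0// prodr_ge0.
have mp : measurable_fun setT (fun t : n.-tuple R => gauss_pdf t x).
  exact: (measurable_prod_tnth (fun i => mphi (tnth x i))).
have p0 t : 0 <= gauss_pdf t x by exact: prodr_ge0.
have BE : (\int[prior w g]_(t in B) (gauss_pdf t x)%:E <=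
    C%:E * \int[prior w g]_t (gauss_pdf t x)%:E)%E.
  (* Exponential Markov bound: on the ball the squared distance is at most [r ^+ 2], so the product
     of the damping factors times [expR (lam * r ^+ 2)] is at least 1. *)
  have Bk (t : n.-tuple R) : (((fun t => (gauss_pdf t x)%:E) \_ B) t <=
      (expR (lam * r ^+ 2))%:E * (\prod_(i < n) u i (tnth t i))%:E)%E.
    rewrite /patch; case: ifPn => [tB|_]; last first.
      by rewrite -EFinM lee_fin mulr_ge0 ?expR_ge0// prodr_ge0.
    rewrite -EFinM lee_fin big_split/= mulrA ler_peMl// /k -expR_sum -expRD.
    rewrite -[leLHS]expR0 ler_expR sumrN -mulr_sumr -mulrBr mulr_ge0// subr_ge0.
    move: tB; rewrite inE /B/= /l2norm => /(le_trans _) tB.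
    rewrite -(@sqr_sqrtr _ (\sum_(i < n) _)) ?sumr_ge0//; last first.
      by move=> i _; exact: sqr_ge0.
    by rewrite ler_pXn2r ?nnegrE ?sqrtr_ge0 ?tB.
  rewrite integral_mkcond; apply: (@le_trans _ _ (\int[prior w g]_t
      ((expR (lam * r ^+ 2))%:E * (\prod_(i < n) u i (tnth t i))%:E))%E).
    apply: ge0_le_integralT => // t; rewrite /patch; case: ifPn => // _.
    by rewrite lee_fin.
  have mU := measurable_prod_tnth mu.
  rewrite ge0_integralZl//=; last 2 first.
  - by apply/measurable_EFinP; exact: mU.
  - by move=> t _; rewrite lee_fin prodr_ge0.
  rewrite /C EFinM -muleA lee_wpmul2l ?lee_fin ?expR_ge0//.
  apply: le_integral_mixture; [exact/measurable_EFinP| |exact/measurable_EFinP| |].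
  - by move=> t; rewrite lee_fin prodr_ge0.
  - by move=> t; rewrite lee_fin.
  move=> p; apply: le_integral_mixture;
    [exact/measurable_EFinP| |exact/measurable_EFinP| |].
  - by move=> t; rewrite lee_fin prodr_ge0.
  - by move=> t; rewrite lee_fin.
  move=> S.
  rewrite (integral_subset_prior (gE S) mh h0 mu u0 NE).
  rewrite (integral_subset_prior (gE S) mh h0
    (fun i => mphi (tnth x i)) (fun i y => phi0 y (tnth x i)) DE).
  rewrite -EFinM lee_fin -big_split/=; apply: ler_prod => i _.
  have N0 : 0 <= N i.
    rewrite -lee_fin -NE; apply: integral_ge0 => y _.
    by rewrite lee_fin mulr_ge0// u0.
  case: ifPn => _; first by rewrite N0 ND.
  by rewrite u0/= ler_wpM2r// /k sub0r sqrrN.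
rewrite /posterior /Rintegral.
set IB := (\int[_]_(t in B) _)%E in BE *; set IT := (\int[_]_t _)%E in BE *.
have IT0 : (0 <= IT)%E by apply: integral_ge0 => t _; rewrite lee_fin.
have IB0 : (0 <= IB)%E by apply: integral_ge0 => t _; rewrite lee_fin.
(* A null or infinite normalizing integral has [fine] equal to 0, and division by 0 gives 0, so the
   bound is then trivial. *)
have [->|ITn0] := eqVneq (fine IT) 0; first by rewrite invr0 mulr0.
have IT_gt0 : 0 < fine IT by rewrite lt_neqAle eq_sym ITn0 fine_ge0.
have ITfin : IT \is a fin_num.
  by move: IT_gt0; case: IT {BE IT0 ITn0} => //=; rewrite ltxx.
rewrite ler_pdivrMr// -lee_fin EFinM (fineK ITfin) fineK//.
by rewrite ge0_fin_numE// (le_lt_trans BE)// -(fineK ITfin) -EFinM ltry.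
Qed.

End product_integrals.

(** * The potential [`|y| `^ alpha] *)

Section power_potential.
Context {R : realType}.
Implicit Types alpha a b y : R.

(* The order of magnitude of the shift of the posterior mean at a. *)
Definition shrinkage alpha a : R :=
  Num.min `|a| (`|a| `^ Num.min 1 (alpha - 1)).

Lemma shrinkage_ge0 alpha a : 0 <= shrinkage alpha a.
Proof. by rewrite /shrinkage le_min normr_ge0 powR_ge0. Qed.

Lemma shrinkage_le_norm alpha a : shrinkage alpha a <= `|a|.
Proof. by rewrite /shrinkage ge_min lexx. Qed.

Lemma shrinkage_small alpha a : `|a| <= 1 -> shrinkage alpha a = `|a|.
Proof.
move=> a1; rewrite /shrinkage; apply/min_idPl.
have [->|a0] := eqVneq a 0; first by rewrite normr0 powR_ge0.
by apply: ger1_powR; rewrite ?normr_gt0 ?a0// ge_min lexx.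
Qed.

Lemma shrinkage_large alpha a : 1 <= `|a| ->
  shrinkage alpha a = `|a| `^ Num.min 1 (alpha - 1).
Proof.
by move=> a1; rewrite /shrinkage; apply/min_idPr/ler1_powR; rewrite // ge_min lexx.
Qed.

Lemma shrinkage_ge_norm alpha a : 2 <= alpha -> shrinkage alpha a = `|a|.
Proof.
move=> alpha2; have [/shrinkage_small->//|/ltW a1] := leP `|a| 1.
rewrite shrinkage_large// (min_idPl _) ?powRr1//.
by rewrite lerBrDr (le_trans _ alpha2).
Qed.

(** For large arguments the shrinkage is a power with the positive exponent [beta], so the threshold
    is the inverse power of [W]. It serves to absorb constant prefactors for large means. *)
Lemma shrinkage_unbounded alpha (W : R) : 1 < alpha ->
  exists2 C : R, 1 <= C & forall a, C <= `|a| -> W <= shrinkage alpha a.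
Proof.
move=> alpha1; pose beta := Num.min 1 (alpha - 1).
have beta0 : 0 < beta by rewrite lt_min ltr01 subr_gt0.
pose V := Num.max 1 W.
have V0 : 0 <= V by rewrite le_max ler01.
exists (Num.max 1 (V `^ beta^-1)) => [|a]; first by rewrite le_max lexx.
rewrite ge_max => /andP[a1 aV]; rewrite shrinkage_large//.
rewrite (@le_trans _ _ V) ?le_max ?lexx ?orbT//.
have -> : V = (V `^ beta^-1) `^ beta by rewrite -powRrM mulVf ?gt_eqF// powRr1.
by rewrite ge0_ler_powR ?nnegrE ?powR_ge0// ltW.
Qed.

(** This is the exponent integrated in [integral_damping_le]. Write g for the shrinkage. Moving the
    centre from [a] to a point [b] nearer to 0 lowers [M] by g^2/8 below the potential at [a], at
    the price of g^2/16 in the cross term. The net gain g^2/16 also has to pay for the terms linear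
    in the distance of [y] to [a]. *)
Lemma shift_exponent_le2 alpha lam a : 1 < alpha -> alpha <= 2 -> 42 <= lam ->
  8 <= shrinkage alpha a ->
  exists b M, (forall y, `|y - b| <= 1 -> `|y| `^ alpha <= M) /\
    forall y, M - lam * (y - a) ^+ 2 - `|y| `^ alpha + (y - b) * (a - b)
      <= - (shrinkage alpha a ^+ 2 / 32) - (y - a) ^+ 2.
Proof.
move=> alpha1 alpha2 lam42 g8.
have A8 : 8 <= `|a| by rewrite (le_trans g8)// shrinkage_le_norm.
have A1 : 1 <= `|a| by lra.
have gA := shrinkage_le_norm alpha a.
have gE : `|a| * shrinkage alpha a = `|a| `^ alpha.
  rewrite shrinkage_large// (min_idPr _); last by lra.
  by rewrite mulr_powRB1//; lra.
set g := shrinkage alpha a in g8 gA gE *; set A := `|a| in A8 A1 gA gE *.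
have A0 : A != 0 by lra.
(* The centre [a - a * del] lies at distance [g / 4] from [a], towards 0. *)
pose del := g / (4 * A).
have delA : del * A = g / 4 by rewrite /del; field.
have del0 : 0 <= del by rewrite /del divr_ge0//; lra.
have del1 : del <= 1.
  by rewrite /del ler_pdivrMr; lra.
have bE : `|a - a * del| = A - g / 4.
  rewrite -{1}(mulr1 a) -mulrBr normrM (@ger0_norm _ (1 - del)); last by lra.
  by rewrite mulrBr mulr1 [_ * del]mulrC delA.
exists (a - a * del), (A * g - g ^+ 2 / 8); split => [y yb|y].
  (* The unit radius fits into the remaining [g / 8] because [8 <= g]. *)
  have yA : `|y| <= A - g / 8.
    have := ler_distD (a - a * del) y 0; rewrite !subr0 bE; lra.
  apply: (@le_trans _ _ ((A - g / 8) `^ alpha)).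
    by rewrite ge0_ler_powR ?nnegrE//; lra.
  (* For a base in [0, 1] the power [alpha] is at most the base itself, which yields the value
     chosen for [M]. *)
  have -> : A - g / 8 = A * (1 - g / (8 * A)) by field.
  have gA1 : 0 <= g / (8 * A) by rewrite divr_ge0//; lra.
  have gA2 : g / (8 * A) <= 1 / 8 by rewrite ler_pdivrMr; lra.
  rewrite powRM; [|lra|lra].
  rewrite -gE (_ : A * g - _ = A * g * (1 - g / (8 * A))); last by field.
  rewrite ler_wpM2l//; first by rewrite mulr_ge0//; lra.
  by apply: ge1r_powR; lra.
set d := y - a.
have yd : A - `|d| <= `|y|.
  by have := ler_distD y a 0; rewrite !subr0 -/A distrC -/d; lra.
have yal : A * g - 2 * g * `|d| <= `|y| `^ alpha.
  have [Ay|yA] := leP A `|y|.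
    apply: (@le_trans _ _ (A `^ alpha)); last by rewrite ge0_ler_powR ?nnegrE//; lra.
    by rewrite -gE gerBl mulr_ge0//; lra.
  have -> : `|y| = A * (`|y| / A) by field.
  set u := `|y| / A.
  have u0 : 0 <= u by rewrite /u divr_ge0//; lra.
  have u1 : u <= 1 by rewrite /u ler_pdivrMr; lra.
  have uE : u * A = `|y| by rewrite /u divfK.
  rewrite powRM//; last by lra.
  rewrite -gE; have : u ^+ 2 <= u `^ alpha.
    have [->|un0] := eqVneq u 0; first by rewrite expr0n/= powR_ge0.
    by rewrite -powR_mulrn// ger_powR// lt_neqAle eq_sym un0 u0.
  move=> u2; apply: (@le_trans _ _ (A * g * u ^+ 2)); last first.
    by rewrite ler_wpM2l// mulr_ge0//; lra.
  apply: (@le_trans _ _ (A * g * (2 * u - 1))); last first.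
    rewrite ler_wpM2l ?mulr_ge0//; [lra|lra|].
    by have := sqr_ge0 (u - 1); nra.
  have -> : A * g * (2 * u - 1) = g * (2 * (u * A) - A) by ring.
  by rewrite uE (_ : A * g - _ = g * (A - 2 * `|d|)); [rewrite ler_wpM2l//; lra|ring].
have cross : (y - (a - a * del)) * (a - (a - a * del)) <= `|d| * (g / 4) + g ^+ 2 / 16.
  have -> : (y - (a - a * del)) * (a - (a - a * del)) = d * (a * del) + (a * del) ^+ 2.
    by rewrite /d; ring.
  have adE : `|a * del| = g / 4 by rewrite normrM (ger0_norm del0) mulrC delA.
  rewrite -(real_normK (num_real (a * del))) adE lerD//; last first.
    by rewrite expr_div_n; lra.
  by rewrite (le_trans (ler_norm _))// normrM adE.
(* With e the distance of [y] to [a], the exponent is at most -g^2/16 + (9/4) g e - lam e^2. The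
   square divided by 32 bounds (9/4) g e by g^2/32 + (81/2) e^2, and [lam >= 42] pays for this and
   for the extra e^2. *)
have := sqr_ge0 (g - 36 * `|d|); rewrite -(real_normK (num_real d)).
move: (`|d|) (normr_ge0 d) yal cross => e e0 yal cross sq.
have : 42 * e ^+ 2 <= lam * e ^+ 2 by rewrite ler_wpM2r// sqr_ge0.
nra.
Qed.

(** Beyond a fixed threshold the potential exceeds twice the square, a stronger pull to 0 than the
    cross term can offset. So the centre [b] can be 0, at the cost of a constant. *)
Lemma shift_exponent_gt2 alpha : 2 < alpha ->
  exists2 K : R, 0 <= K & forall lam a, 42 <= lam ->
  exists b M, (forall y, `|y - b| <= 1 -> `|y| `^ alpha <= M) /\
    forall y, M - lam * (y - a) ^+ 2 - `|y| `^ alpha + (y - b) * (a - b)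
      <= K - (a ^+ 2 / 2) - (y - a) ^+ 2.
Proof.
(* [T] is the point where the power [alpha - 2] reaches 2. *)
move=> alpha2; pose T := 2 `^ (alpha - 2)^-1 : R.
have T0 : 0 <= T by exact: powR_ge0.
have yT y : 2 * y ^+ 2 - 2 * T ^+ 2 <= `|y| `^ alpha.
  rewrite -(real_normK (num_real y)); have [Ty|yT] := leP T `|y|; last first.
    rewrite (@le_trans _ _ 0) ?powR_ge0// subr_le0 ler_pM2l//.
    by rewrite ler_pXn2r ?nnegrE// ltW.
  have y2 : 2 <= `|y| `^ (alpha - 2).
    have TE : T `^ (alpha - 2) = 2.
      by rewrite -powRrM mulVf ?powRr1//; lra.
    rewrite -[leLHS]TE.
    by rewrite ge0_ler_powR ?nnegrE//; lra.
  have y0 : 0 < `|y|.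
    by apply: lt_le_trans Ty; rewrite powR_gt0.
  have -> : `|y| `^ alpha = `|y| `^ (alpha - 2) * `|y| ^+ 2.
    rewrite -(powR_mulrn 2)// -powRD; last by apply/implyP => _; rewrite gt_eqF.
    by congr (_ `^ _); ring.
  apply: (@le_trans _ _ (2 * `|y| ^+ 2)); first by have := sqr_ge0 T; lra.
  by rewrite ler_wpM2r// sqr_ge0.
exists (1 + 2 * T ^+ 2) => [|lam a lam42]; first by have := sqr_ge0 T; lra.
exists 0, 1; split => [y|y].
  rewrite subr0 => y1; apply: (@le_trans _ _ (1 `^ alpha)); last by rewrite powR1.
  by rewrite ge0_ler_powR ?nnegrE//; lra.
have := yT y; have := sqr_ge0 (y - a); have := sqr_ge0 (a + 3 * (y - a)).
have : 42 * (y - a) ^+ 2 <= lam * (y - a) ^+ 2 by rewrite ler_wpM2r// sqr_ge0.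
nra.
Qed.

Lemma shift_exponent alpha : 1 < alpha ->
  exists2 K : R, 0 <= K & forall lam a, 42 <= lam -> 8 <= shrinkage alpha a ->
  exists b M, (forall y, `|y - b| <= 1 -> `|y| `^ alpha <= M) /\
    forall y, M - lam * (y - a) ^+ 2 - `|y| `^ alpha + (y - b) * (a - b)
      <= K - (shrinkage alpha a ^+ 2 / 32) - (y - a) ^+ 2.
Proof.
move=> alpha1; have [alpha2|/[dup] alpha2] := leP alpha 2.
  exists 0 => // lam a lam42 g8.
  by have [b [M bM]] := shift_exponent_le2 alpha1 alpha2 lam42 g8;
    exists b, M; rewrite sub0r.
move=> /shift_exponent_gt2[K K0 KP]; exists K => // lam a lam42 g8.
have [b [M [bM yM]]] := KP lam a lam42; exists b, M; split => // y.
rewrite (le_trans (yM y))// lerB// lerB//.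
have : shrinkage alpha a ^+ 2 <= `|a| ^+ 2.
  by rewrite ler_pXn2r ?nnegrE ?shrinkage_ge0// shrinkage_le_norm.
rewrite real_normK ?num_real//; have := sqr_ge0 a; lra.
Qed.

End power_potential.

(** * The posterior of a single coordinate *)

Section coordinate_posterior.
Context {R : realType}.
Notation mu := (@lebesgue_measure R).
Implicit Types lam a b x y M : R.

Lemma normal_pdf1E (m x : R) :
  normal_pdf m 1 x = normal_peak 1 * expR (- ((x - m) ^+ 2 / 2)).
Proof. by rewrite normal_pdfE ?oner_eq0// /normal_fun expr1n mulNr. Qed.

Lemma integral_gauss lam a : 0 < lam ->
  (\int[mu]_y (expR (- (lam * (y - a) ^+ 2)))%:E = (Num.sqrt (pi / lam))%:E)%E.
Proof.
move=> lam0; pose s := Num.sqrt (2 * lam)^-1 : R.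
have s2 : s ^+ 2 *+ 2 = lam^-1.
  rewrite /s sqr_sqrtr; last by rewrite invr_ge0 mulr_ge0// ltW.
  by rewrite -mulr_natl invfM mulrA divff// mul1r.
have s0 : s != 0 by rewrite gt_eqF// sqrtr_gt0 invr_gt0 mulr_gt0.
have peakE : normal_peak s = (Num.sqrt (pi / lam))^-1.
  by rewrite /normal_peak -mulrnAl s2 [_^-1 * _]mulrC.
have sq0 : Num.sqrt (pi / lam) != 0.
  by rewrite gt_eqF// sqrtr_gt0 divr_gt0 ?pi_gt0.
transitivity (\int[mu]_y ((Num.sqrt (pi / lam))%:E * (normal_pdf a s y)%:E))%E.
  apply: eq_integral => y _; rewrite -EFinM normal_pdfE// peakE mulVKf//.
  by rewrite /normal_fun s2 invrK mulNr mulrC [_ * lam]mulrC.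
rewrite ge0_integralZl//=.
- by rewrite integral_normal_pdf mule1.
- by apply/measurable_EFinP; exact: measurable_normal_pdf.
- by move=> y _; rewrite lee_fin normal_pdf_ge0.
Qed.

(** Completing the square moves the reference mean from [a] to [b]. The factor [normal_pdf b 1 x]
    then cancels against the lower bound [post_den_ge], and what remains is a probability density in
    [x]. *)
Lemma normal_pdf_tilt a b x y :
  normal_pdf y 1 x * normal_pdf a 1 x
  = expR ((y - b) * (a - b)) * normal_pdf (y + a - b) 1 x * normal_pdf b 1 x.
Proof.
rewrite !normal_pdf1E.
set p := normal_peak 1.
transitivity (p ^+ 2 * expR (- ((x - y) ^+ 2 / 2) - ((x - a) ^+ 2 / 2))).
  by rewrite expRD; ring.
transitivity (p ^+ 2 * expR ((y - b) * (a - b) - (x - (y + a - b)) ^+ 2 / 2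
   - (x - b) ^+ 2 / 2)); last by rewrite !expRD; ring.
by congr (_ * expR _); field.
Qed.

Variables (q h : R -> R) (kap : R).
Hypothesis mq : measurable_fun setT q.
Hypothesis kap0 : 0 <= kap.
Hypothesis hE : forall y, h y = kap * expR (- q y).
Hypothesis h1 : (\int[mu]_y (h y)%:E = 1)%E.

Let mh : measurable_fun setT h.
Proof.
rewrite (_ : h = fun y => kap * expR (- q y)); last exact/funext.
by apply: measurable_funM => //; apply: measurableT_comp => //; exact: measurableT_comp.
Qed.

Let h0 y : 0 <= h y. Proof. by rewrite hE mulr_ge0 ?expR_ge0. Qed.

Let kap_gt0 : 0 < kap.
Proof.
rewrite lt_neqAle kap0 andbT; apply/eqP => k0; move: h1.
rewrite integral0_eq => [/eqP|y _]; first by rewrite eq_sym onee_eq0.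
by rewrite hE -k0 mul0r.
Qed.

Definition post_num lam a x : \bar R :=
  (\int[mu]_y (expR (- (lam * (y - a) ^+ 2)) * normal_pdf y 1 x * h y)%:E)%E.

Definition post_den x : \bar R := (\int[mu]_y (normal_pdf y 1 x * h y)%:E)%E.

(* The mean of [expR (- (lam * (y - a) ^+ 2))] under the posterior of a single
   coordinate, given that it is drawn from h and observed as x. *)
Definition damping lam a x := fine (post_num lam a x) / fine (post_den x).

Let mnum lam a x : measurable_fun setT
  (fun y => (expR (- (lam * (y - a) ^+ 2)) * normal_pdf y 1 x * h y)%:E).
Proof.
apply/measurable_EFinP; apply: measurable_funM => //; apply: measurable_funM.
  exact: measurable_expR_sqr.
exact: measurable_normal_pdf_mean.
Qed.

Lemma post_num_ge0 lam a x : (0 <= post_num lam a x)%E.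
Proof.
apply: integral_ge0 => y _.
by rewrite lee_fin !mulr_ge0 ?expR_ge0 ?normal_pdf_ge0.
Qed.

Lemma post_num_le_den lam a x : 0 <= lam -> (post_num lam a x <= post_den x)%E.
Proof.
move=> lam0; apply: ge0_le_integralT => y.
  by rewrite lee_fin !mulr_ge0 ?expR_ge0 ?normal_pdf_ge0.
rewrite lee_fin ler_wpM2r// ler_piMl ?normal_pdf_ge0//.
by rewrite -expR0 ler_expR oppr_le0 mulr_ge0// sqr_ge0.
Qed.

Lemma post_den_fin_num x : post_den x \is a fin_num.
Proof.
rewrite ge0_fin_numE; last first.
  by apply: integral_ge0 => y _; rewrite lee_fin mulr_ge0 ?normal_pdf_ge0.
apply: (@le_lt_trans _ _ (\int[mu]_y ((normal_peak 1)%:E * (h y)%:E))%E).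
  apply: ge0_le_integralT => y; first by rewrite lee_fin mulr_ge0 ?normal_pdf_ge0.
  by rewrite -EFinM lee_fin ler_wpM2r// normal_pdf_ub ?oner_eq0.
rewrite ge0_integralZl//=.
- by rewrite h1 mule1 ltry.
- exact/measurable_EFinP.
- by move=> y _; rewrite lee_fin.
- by rewrite lee_fin normal_peak_ge0.
Qed.

Lemma post_num_fin_num lam a x : 0 <= lam -> post_num lam a x \is a fin_num.
Proof.
move=> lam0; rewrite ge0_fin_numE ?post_num_ge0//.
by rewrite (le_lt_trans (post_num_le_den _ _ _))// ltey_eq post_den_fin_num.
Qed.

(** The integral is restricted to an interval of length 1 on one side of [b], the side depending on
    [x]. There the quadratic term of the log-likelihood costs at most 1/2 and the potential at most
    [M]. *)
Lemma post_den_ge b M x : (forall y, `|y - b| <= 1 -> q y <= M) ->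
  ((kap * expR (- (1 / 2 + M)) * normal_pdf b 1 x)%:E <= post_den x)%E.
Proof.
move=> qM; set C := kap * _ * _.
have C0 : 0 <= C by rewrite !mulr_ge0 ?expR_ge0 ?normal_pdf_ge0.
(* On this half of [[b - 1, b + 1]] the linear term [(x - b) * (y - b)] of the
   log-likelihood is nonnegative. *)
pose I : set R := if b <= x then `[b, b + 1]%classic else `[b - 1, b]%classic.
have mI : measurable I by rewrite /I; case: ifP.
have muI : mu I = 1%E.
  rewrite /I; case: ifP => _; rewrite lebesgue_measure_itv/= lte_fin.
    by rewrite ltrDl ltr01 -EFinB addrAC subrr add0r.
  by rewrite gtrBl ltr01 -EFinB opprB addrCA subrr addr0.
apply: (@le_trans _ _ (\int[mu]_(y in I) C%:E)%E).
  have -> : (\int[mu]_(y in I) C%:E = C%:E * mu I)%E by exact: integral_cst.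
  by rewrite muI mule1.
rewrite integral_mkcond; apply: ge0_le_integralT => y; rewrite /patch.
  by case: ifP => // _; rewrite lee_fin.
case: ifPn => [yI|_]; last by rewrite lee_fin mulr_ge0// normal_pdf_ge0.
have [yb1 xyb] : `|y - b| <= 1 /\ 0 <= (x - b) * (y - b).
  move: yI; rewrite inE /I; case: leP => xb /=; rewrite in_itv/= => /andP[y1 y2].
    by split; [rewrite ler_norml; lra|rewrite mulr_ge0//; lra].
  by split; [rewrite ler_norml; lra|rewrite mulr_le0//; lra].
rewrite lee_fin /C hE !normal_pdf1E.
set p := normal_peak 1; have p0 : 0 <= p by exact: normal_peak_ge0.
have -> : kap * expR (- (1 / 2 + M)) * (p * expR (- ((x - b) ^+ 2 / 2)))
    = p * kap * expR (- (1 / 2 + M) - (x - b) ^+ 2 / 2) by rewrite expRD; ring.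
have -> : p * expR (- ((x - y) ^+ 2 / 2)) * (kap * expR (- q y))
    = p * kap * expR (- q y - (x - y) ^+ 2 / 2) by rewrite expRD; ring.
rewrite ler_wpM2l ?mulr_ge0// ler_expR.
have := qM _ yb1; have : (y - b) ^+ 2 <= 1.
  by rewrite -(real_normK (num_real (y - b))) expr_le1.
by move: xyb; nra.
Qed.

Lemma post_den_gt0 b M x : (forall y, `|y - b| <= 1 -> q y <= M) ->
  0 < fine (post_den x).
Proof.
move=> qM; rewrite -lte_fin fineK ?post_den_fin_num//.
apply: lt_le_trans (post_den_ge x qM).
by rewrite lte_fin !mulr_gt0 ?expR_gt0// normal_pdf1E mulr_gt0 ?expR_gt0//
  normal_peak_gt0// oner_eq0.
Qed.

Lemma damping_ge0 lam a x : 0 <= damping lam a x.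
Proof.
rewrite divr_ge0// fine_ge0 ?post_num_ge0//.
by apply: integral_ge0 => y _; rewrite lee_fin mulr_ge0 ?normal_pdf_ge0.
Qed.

Let measurable_normal_pdf2 (s : R * R -> R) : measurable_fun setT s ->
  measurable_fun setT (fun z : R * R => normal_pdf (s z) 1 z.1).
Proof.
move=> ms; rewrite (_ : (fun z => _) = normal_pdf 0 1 \o (fun z => z.1 - s z)).
  apply: measurableT_comp; first exact: measurable_normal_pdf.
  by apply: measurable_funB.
by apply/funext => z /=; rewrite !normal_pdf1E subr0.
Qed.

Let measurable_damp2 lam a : measurable_fun setT (fun z : R * R =>
  expR (- (lam * (z.2 - a) ^+ 2))).
Proof. exact: (measurableT_comp (measurable_expR_sqr lam a) measurable_snd). Qed.

Lemma measurable_post_num lam a : measurable_fun setT (post_num lam a).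
Proof.
apply: (@measurable_fun_fubini_tonelli_F _ _ _ _ _ mu (fun z : R * R =>
  (expR (- (lam * (z.2 - a) ^+ 2)) * normal_pdf z.2 1 z.1 * h z.2)%:E)).
  apply/measurable_EFinP; apply: measurable_funM; last first.
    exact: (measurableT_comp mh measurable_snd).
  apply: measurable_funM; first exact: measurable_damp2.
  exact: (@measurable_normal_pdf2 snd measurable_snd).
by move=> z; rewrite lee_fin !mulr_ge0 ?expR_ge0 ?normal_pdf_ge0.
Qed.

Lemma measurable_damping lam a : measurable_fun setT (damping lam a).
Proof.
have mnum_ l : measurable_fun setT (fun x => fine (post_num l a x)).
  by apply: measurableT_comp => //; exact: measurable_post_num.
(* At [lam = 0] the numerator is the denominator, and on nonnegative reals inversion is the power
   -1. *)
rewrite (_ : damping lam a = fun x =>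
    fine (post_num lam a x) * (fine (post_num 0 a x)) `^ (-1)).
  apply: measurable_funM => //.
  exact: (measurableT_comp (measurable_powR (-1)) (mnum_ 0)).
apply/funext => x; rewrite /damping; congr (_ * _).
rewrite powR_inv1 ?fine_ge0 ?post_num_ge0//; congr (fine _)^-1.
by apply: eq_integral => y _; rewrite mul0r oppr0 expR0 mul1r.
Qed.

(** The denominator is replaced by its lower bound at [b] and the numerator is tilted by
    [normal_pdf_tilt]. After exchanging the integrals, the inner one is that of a normal density in
    [x], which is 1. *)
Lemma integral_damping_le lam a b M : 0 <= lam ->
  (forall y, `|y - b| <= 1 -> q y <= M) ->
  (\int[mu]_x (damping lam a x * normal_pdf a 1 x)%:E <= \int[mu]_y
     (expR (1 / 2 + (M - lam * (y - a) ^+ 2 - q y + (y - b) * (a - b))))%:E)%E.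
Proof.
move=> lam0 qM.
pose G (y : R) := 1 / 2 + (M - lam * (y - a) ^+ 2 - q y + (y - b) * (a - b)).
have mG : measurable_fun setT (fun y => expR (G y)).
  apply: measurableT_comp => //; rewrite /G; apply: measurable_funD => //.
  apply: measurable_funD; last by apply: measurable_funM => //; exact: measurable_funB.
  apply: measurable_funB => //; apply: measurable_funB => //.
  by apply: measurable_funM => //; apply: measurable_funX; exact: measurable_funB.
apply: (@le_trans _ _ (\int[mu]_x \int[mu]_y
    (expR (G y) * normal_pdf (y + a - b) 1 x)%:E))%E.
  apply: ge0_le_integralT => x.
    by rewrite lee_fin mulr_ge0 ?damping_ge0 ?normal_pdf_ge0.
  have den0 := post_den_gt0 x qM.
  have phib : 0 < normal_pdf b 1 x.
    by rewrite normal_pdf1E mulr_gt0 ?expR_gt0// normal_peak_gt0// oner_eq0.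
  have -> : (\int[mu]_y (expR (G y) * normal_pdf (y + a - b) 1 x)%:E =
      ((kap * expR (- (1 / 2 + M)) * normal_pdf b 1 x)^-1 * normal_pdf a 1 x)%:E *
      post_num lam a x)%E.
    rewrite -ge0_integralZl//=; last 3 first.
    - exact: mnum.
    - by move=> y _; rewrite lee_fin !mulr_ge0 ?expR_ge0 ?normal_pdf_ge0.
    - by rewrite lee_fin mulr_ge0 ?invr_ge0 ?mulr_ge0 ?expR_ge0 ?normal_pdf_ge0.
    apply: eq_integral => y _; rewrite -EFinM; congr EFin.
    transitivity ((kap * expR (- (1 / 2 + M)) * normal_pdf b 1 x)^-1 *
      (expR (- (lam * (y - a) ^+ 2)) * h y *
       (normal_pdf y 1 x * normal_pdf a 1 x))); last by ring.
    rewrite (normal_pdf_tilt a b x y) hE /G.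
    have -> : 1 / 2 + (M - lam * (y - a) ^+ 2 - q y + (y - b) * (a - b)) =
      (1 / 2 + M) - lam * (y - a) ^+ 2 - q y + (y - b) * (a - b) by ring.
    rewrite (expRN (1 / 2 + M)) !expRD; field.
    by rewrite !gt_eqF ?expR_gt0.
  rewrite -(fineK (post_num_fin_num _ _ lam0)) -EFinM lee_fin /damping.
  rewrite [leRHS]mulrC [leRHS]mulrA ler_wpM2r ?normal_pdf_ge0//.
  rewrite ler_wpM2l ?fine_ge0 ?post_num_ge0//.
  rewrite lef_pV2 ?posrE// ?mulr_gt0 ?expR_gt0//.
  by rewrite -lee_fin fineK ?post_den_fin_num// post_den_ge.
rewrite (@fubini_tonelli _ _ _ _ _ mu mu (fun z : R * R =>
  (expR (G z.2) * normal_pdf (z.2 + a - b) 1 z.1)%:E))/=; last 2 first.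
- apply/measurable_EFinP; apply: measurable_funM.
    exact: (measurableT_comp mG measurable_snd).
  apply: (@measurable_normal_pdf2 (fun z => z.2 + a - b)).
  by apply: measurable_funB => //; exact: measurable_funD.
- by move=> z; rewrite lee_fin mulr_ge0 ?expR_ge0 ?normal_pdf_ge0.
rewrite le_eqVlt; apply/orP; left; apply/eqP; apply: eq_integral => y _.
under eq_integral do rewrite EFinM.
rewrite ge0_integralZl//=.
- by rewrite integral_normal_pdf mule1.
- by apply/measurable_EFinP; exact: measurable_normal_pdf.
- by move=> x _; rewrite lee_fin normal_pdf_ge0.
Qed.

End coordinate_posterior.

(** * Exponential bound for the factor of one coordinate *)

Section coordinate_factor.
Context {R : realType}.
Notation mu := (@lebesgue_measure R).
Variables (alpha kap : R) (h : R -> R).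
Hypothesis alpha1 : 1 < alpha.
Hypothesis kap0 : 0 <= kap.
Hypothesis hE : forall y, h y = kap * expR (- `|y| `^ alpha).
Hypothesis h1 : (\int[mu]_y (h y)%:E = 1)%E.

Let alpha0 : 0 <= alpha. Proof. exact: le_trans ler01 (ltW alpha1). Qed.

Let q (y : R) := `|y| `^ alpha.

Let mq : measurable_fun setT q.
Proof. by apply: (measurableT_comp (measurable_powR alpha)). Qed.

Let E lam a := (\int[mu]_x (damping h lam a x * normal_pdf a 1 x)%:E)%E.

(** The term [- (y - a) ^+ 2] kept in [shift_exponent] makes the remaining integral Gaussian, with a
    value independent of [lam] and [a]. *)
Lemma integral_damping_large : exists2 K : R, 0 <= K &
  forall lam a, 42 <= lam -> 8 <= shrinkage alpha a ->
  (E lam a <= (K * expR (- (shrinkage alpha a ^+ 2 / 32)))%:E)%E.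
Proof.
have [K K0 KP] := shift_exponent alpha1.
exists (expR (1 / 2 + K) * Num.sqrt (pi / 1)).
  by rewrite mulr_ge0 ?expR_ge0 ?sqrtr_ge0.
move=> lam a lam42 g8; have [b [M [qM yM]]] := KP lam a lam42 g8.
have lam0 : 0 <= lam by lra.
apply: (le_trans (integral_damping_le mq kap0 hE h1 a lam0 qM)).
set g := shrinkage alpha a in yM *.
apply: (@le_trans _ _ (\int[mu]_y ((expR (1 / 2 + K) * expR (- (g ^+ 2 / 32)))%:E *
    (expR (- (1 * (y - a) ^+ 2)))%:E))%E).
  apply: ge0_le_integralT => y; first by rewrite lee_fin expR_ge0.
  rewrite -EFinM lee_fin -!expRD ler_expR.
  by have := yM y; rewrite /q; lra.
rewrite ge0_integralZl//=.
- by rewrite integral_gauss// -EFinM lee_fin mulrAC.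
- by apply/measurable_EFinP; exact: measurable_expR_sqr.
Qed.

(** With the centre [b = a] the cross term vanishes. No decay in [a] is gained, but the bound
    becomes small as [lam] grows. *)
Lemma integral_damping_small C lam a : 0 < lam -> `|a| <= C ->
  (E lam a <= (expR (1 / 2 + (C + 1) `^ alpha) * Num.sqrt (pi / lam))%:E)%E.
Proof.
move=> lam0 aC.
have qM y : `|y - a| <= 1 -> q y <= (C + 1) `^ alpha.
  move=> ya; have C0 : 0 <= C by rewrite (le_trans _ aC).
  have yC : `|y| <= C + 1 by have := ler_distD a y 0; rewrite !subr0; lra.
  by rewrite ge0_ler_powR ?nnegrE//; lra.
apply: (le_trans (integral_damping_le mq kap0 hE h1 a (ltW lam0) qM)).
set M := (C + 1) `^ alpha.
apply: (@le_trans _ _ (\int[mu]_y ((expR (1 / 2 + M))%:E *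
    (expR (- (lam * (y - a) ^+ 2)))%:E))%E).
  apply: ge0_le_integralT => y; first by rewrite lee_fin expR_ge0.
  rewrite -EFinM lee_fin -!expRD ler_expR subrr mulr0.
  by have : 0 <= q y by [exact: powR_ge0]; rewrite /q; lra.
rewrite ge0_integralZl//=.
- by rewrite integral_gauss// -EFinM.
- by apply/measurable_EFinP; exact: measurable_expR_sqr.
Qed.

(** A coordinate outside the support has factor [t], one inside has the damping [psi], and 1 - (1 -
    t)(1 - psi) dominates both. The plain sum would be too large near [a = 0], where [t] is close to
    1. For large [a] both terms decay in the shrinkage; for bounded [a] a large [lam] gives [psi]
    mean at most 1/2, and the gain comes from [1 - t]. *)
Lemma coordinate_factor : exists lam c : R, [/\ 0 < lam, 0 < c &
  forall a : R, exists (F : R -> R) (e : R), [/\ measurable_fun setT F,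
    forall x, expR (- (lam * a ^+ 2)) <= F x,
    forall x, fine (post_num h lam a x) <= F x * fine (post_den h x),
    (\int[mu]_x (F x * normal_pdf a 1 x)%:E = e%:E)%E &
    e <= expR (- (c * shrinkage alpha a ^+ 2))]].
Proof.
have [K K0 KP] := integral_damping_large.
(* The 8 meets the condition of [integral_damping_large]; [64 * K] lets [expR (g ^+ 2 / 64)] absorb
   the prefactor [1 + K]. *)
have [C C1 CP] := shrinkage_unbounded (8 + 64 * K) alpha1.
pose B := expR (1 / 2 + (C + 1) `^ alpha).
have B0 : 0 < B by exact: expR_gt0.
(* 42 is what the large means require; the other entry makes [B * Num.sqrt (pi / lam)] at most 1/2
   for the small ones. *)
pose lam := Num.max 42 (4 * B ^+ 2 * pi).
have lam42 : 42 <= lam by rewrite le_max lexx.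
have lam0 : 0 < lam by lra.
have lamB : B * Num.sqrt (pi / lam) <= 1 / 2.
  rewrite mulrC -ler_pdivlMr//.
  have -> : 1 / 2 / B = Num.sqrt ((1 / 2 / B) ^+ 2).
    by rewrite sqrtr_sqr ger0_norm// divr_ge0// ltW.
  rewrite ler_sqrt ?sqr_ge0// ler_pdivrMr//.
  apply: (@le_trans _ _ ((1 / 2 / B) ^+ 2 * (4 * B ^+ 2 * pi))).
    rewrite le_eqVlt; apply/orP; left; apply/eqP; field.
    by rewrite gt_eqF.
  by rewrite ler_wpM2l ?sqr_ge0// le_max lexx orbT.
have CC0 : 0 < 1 + C ^+ 2 by have := sqr_ge0 C; lra.
(* 1/64 is the rate left for large means after absorbing [1 + K]; the other entry is the rate
   obtained when the absolute value of [a] is at most [C]. *)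
pose c := Num.min (1 / 64) (1 / 2 / (1 + C ^+ 2)) : R.
exists lam, c; split => // [|a].
  by rewrite lt_min !divr_gt0.
pose t := expR (- (lam * a ^+ 2)).
have t0 : 0 <= t by exact: expR_ge0.
have t1 : t <= 1.
  by rewrite -expR0 ler_expR oppr_le0 mulr_ge0 ?sqr_ge0// ltW.
pose psi := damping h lam a.
have psi0 x : 0 <= psi x by exact: damping_ge0 hE _ _ _.
have q1 y : `|y - 0| <= 1 -> q y <= 1.
  rewrite subr0 => y1; apply: (@le_trans _ _ (1 `^ alpha)); last by rewrite powR1.
  by rewrite ge0_ler_powR ?nnegrE//; lra.
have den0 x : 0 < fine (post_den h x).
  exact: (@post_den_gt0 _ q h kap mq kap0 hE h1 0 1 x q1).
have psi1 x : psi x <= 1.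
  rewrite ler_pdivrMr// mul1r fine_le ?post_den_fin_num//.
  - exact: (post_num_fin_num mq kap0 hE h1 _ _ (ltW lam0)).
  - exact: (post_den_fin_num mq kap0 hE h1).
  - exact: (post_num_le_den kap0 hE _ _ (ltW lam0)).
have mpsi : measurable_fun setT psi by exact: measurable_damping mq kap0 hE _ _.
have phi0 x : 0 <= normal_pdf a 1 x by exact: normal_pdf_ge0.
have mphi := measurable_normal_pdf a (1 : R).
have E0 : (0 <= E lam a)%E.
  by apply: integral_ge0 => x _; rewrite lee_fin mulr_ge0.
have E1 : (E lam a <= 1)%E.
  rewrite -(integral_normal_pdf a 1); apply: ge0_le_integralT => x.
    by rewrite lee_fin mulr_ge0.
  by rewrite lee_fin ler_piMl.
have Efin : E lam a \is a fin_num by rewrite ge0_fin_numE// (le_lt_trans E1) ?ltry.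
pose v := fine (E lam a).
have v0 : 0 <= v by exact: fine_ge0.
have EE : E lam a = v%:E by rewrite fineK.
exists (fun x => t + (1 - t) * psi x), (t + (1 - t) * v); split.
- by apply: measurable_funD => //; exact: measurable_funM.
- by move=> x; rewrite lerDl mulr_ge0// subr_ge0.
- move=> x; apply: (@le_trans _ _ (psi x * fine (post_den h x))).
    by rewrite /psi /damping divfK// gt_eqF.
  rewrite ler_wpM2r//; first by rewrite ltW.
  by have := psi0 x; have := psi1 x; nra.
- transitivity (\int[mu]_x (t%:E * (normal_pdf a 1 x)%:E +
      (1 - t)%:E * (psi x * normal_pdf a 1 x)%:E))%E.
    by apply: eq_integral => x _; rewrite -!EFinM -EFinD; congr EFin; ring.
  have mpp : measurable_fun setT (fun x => (psi x * normal_pdf a 1 x)%:E).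
    by apply/measurable_EFinP; exact: measurable_funM.
  have mpE : measurable_fun setT (fun x => (normal_pdf a 1 x)%:E).
    exact/measurable_EFinP.
  rewrite ge0_integralD//=; last 4 first.
  + by move=> x _; apply: mule_ge0; rewrite lee_fin.
  + exact: emeasurable_funM.
  + move=> x _; apply: mule_ge0; rewrite lee_fin ?subr_ge0//.
    by apply: mulr_ge0 => //; exact: psi0.
  + exact: emeasurable_funM.
  rewrite ge0_integralZl//=; last by move=> x _; rewrite lee_fin.
  rewrite ge0_integralZl//=; last 2 first.
  + by move=> x _; rewrite lee_fin mulr_ge0.
  + by rewrite lee_fin subr_ge0.
  rewrite integral_normal_pdf mule1 -/(E lam a) EE -EFinM -EFinD //.
set g := shrinkage alpha a.
have g0 : 0 <= g by exact: shrinkage_ge0.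
have g2a : g ^+ 2 <= a ^+ 2.
  rewrite -(real_normK (num_real a)) ler_pXn2r ?nnegrE//.
  exact: shrinkage_le_norm.
have [Ca|/ltW aC] := leP C `|a|.
  have gW := CP a Ca; rewrite -/g in gW.
  have : v <= K * expR (- (g ^+ 2 / 32)).
    by rewrite -lee_fin -EE KP//; rewrite -/g; lra.
  have tg : t <= expR (- (g ^+ 2 / 32)).
    rewrite ler_expR lerN2; apply: (@le_trans _ _ (42 * a ^+ 2)).
      by have := sqr_ge0 g; lra.
    by rewrite ler_wpM2r// sqr_ge0.
  move=> vK; apply: (@le_trans _ _ (t + v)); first by nra.
  apply: (@le_trans _ _ ((1 + K) * expR (- (g ^+ 2 / 32)))); first by lra.
  apply: (@le_trans _ _ (expR (g ^+ 2 / 64) * expR (- (g ^+ 2 / 32)))).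
    rewrite ler_wpM2r ?expR_ge0// (le_trans _ (expR_ge1Dx _))//.
    by rewrite lerD2l; nra.
  rewrite -expRD ler_expR.
  have : c * g ^+ 2 <= 1 / 64 * g ^+ 2.
    by rewrite ler_wpM2r ?sqr_ge0// ge_min lexx.
  lra.
have v2 : v <= 1 / 2.
  rewrite -lee_fin -EE (le_trans (integral_damping_small lam0 aC))//.
(* As [v <= 1 / 2], the mean is at most 1 - (1 - t)/2. It remains to bound [1 - t] below by a^2/(1 +
   a^2), which has the quadratic order of the shrinkage at 0. *)
apply: (@le_trans _ _ (expR (- ((1 - t) / 2)))).
  by rewrite (le_trans _ (expR_ge1Dx _))//; nra.
rewrite ler_expR lerN2.
have ta : t <= (1 + a ^+ 2)^-1.
  apply: (@le_trans _ _ (expR (- a ^+ 2))).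
    by rewrite ler_expR lerN2; have := sqr_ge0 a; nra.
  rewrite expRN lef_pV2 ?posrE ?expR_gt0 ?expR_ge1Dx//.
  by have := sqr_ge0 a; lra.
have aC2 : a ^+ 2 <= C ^+ 2.
  by rewrite -(real_normK (num_real a)) ler_pXn2r ?nnegrE//; lra.
apply: (@le_trans _ _ (1 / 2 / (1 + C ^+ 2) * a ^+ 2)).
  by rewrite ler_pM ?sqr_ge0 ?ge_min ?lexx ?orbT// le_min !divr_ge0// ltW.
apply: (@le_trans _ _ (1 / 2 * (1 - (1 + a ^+ 2)^-1))); last by lra.
have a20 := sqr_ge0 a.
rewrite -mulrA ler_wpM2l// [leLHS]mulrC.
have -> : 1 - (1 + a ^+ 2)^-1 = a ^+ 2 / (1 + a ^+ 2).
  by field; lra.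
by rewrite ler_wpM2l// lef_pV2 ?posrE//; lra.
Qed.

End coordinate_factor.

(** * The expected posterior mass of a ball *)

Section expected_posterior.
Context {R : realType}.

(** Normalization of [h] is read off from a one-fold product density. The length [k] is a variable
    because a cardinal [#|S|] equals 1 only propositionally. *)
Lemma integral_density1 k (f : density R k) (h : R -> R) : k = 1%N ->
  (forall y, f y = \prod_(i < k) h (tnth y i)) ->
  measurable_fun setT h -> (forall y, 0 <= h y) ->
  (\int[lebesgue_measure]_y (h y)%:E = 1)%E.
Proof.
move=> k1; subst k => fE mh h0; rewrite -(integral_dens f).
rewrite ge0_integral_lebesgue_tupleS; first last.
- by move=> t; rewrite lee_fin dens_ge0.
- by apply/measurable_EFinP; exact: measurable_dens.
apply: eq_integral => x _.
under eq_integral do rewrite fE big_ord1 [tnth _ _](_ : _ = x)//.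
by rewrite integral_dirac//= diracT mul1e.
Qed.

(** The pointwise bound of [posterior_ball_le] is a product of functions of single observations, so
    its mean is the product of the [e]. The constants depend neither on [n] nor on the weights
    [w]. *)
Lemma expectation_posterior_ball_le (alpha kap : R) (h : R -> R) : 1 < alpha ->
  0 <= kap -> (forall y, h y = kap * expR (- `|y| `^ alpha)) ->
  (\int[lebesgue_measure]_y (h y)%:E = 1)%E ->
  exists lam c : R, [/\ 0 < lam, 0 < c & forall n (w : fin_pmf R 'I_n.+1)
    (g : forall S : {set 'I_n}, density R #|S|) (a : n.-tuple R) (r : R),
    (forall S y, g S y = \prod_(i < #|S|) h (tnth y i)) -> 0 <= r ->
    ('E_(mvnormal a)[(fun x => posterior (prior w g) x
       [set t : n.-tuple R | l2norm (fun i => tnth t i - tnth a i) <= r])%R]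
     <= (expR (lam * r ^+ 2
          - c * \sum_(i < n) shrinkage alpha (tnth a i) ^+ 2))%:E)%E].
Proof.
move=> alpha1 kap0 hE h1.
have [lam [c [lam0 c0 FP]]] := coordinate_factor alpha1 kap0 hE h1.
exists lam, c; split => // n w g a r gE r0.
have mq : measurable_fun setT (fun y : R => `|y| `^ alpha).
  by apply: (measurableT_comp (measurable_powR alpha)).
have mh : measurable_fun setT h.
  rewrite (_ : h = fun y => kap * expR (- `|y| `^ alpha)); last exact/funext.
  apply: measurable_funM => //; apply: measurableT_comp => //.
  exact: measurableT_comp.
have h0 y : 0 <= h y by rewrite hE mulr_ge0 ?expR_ge0.
have /choice[F /choice[e Fe]] := FP.
pose N (x : n.-tuple R) i := fine (post_num h lam (tnth a i) (tnth x i)).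
pose D (x : n.-tuple R) i := fine (post_den h (tnth x i)).
have NE (x : n.-tuple R) i : (\int[lebesgue_measure]_y
    (expR (- (lam * (y - tnth a i) ^+ 2)) * normal_pdf y 1 (tnth x i) * h y)%:E
    = (N x i)%:E)%E.
  by rewrite fineK// (post_num_fin_num mq kap0 hE h1)// ltW.
have DE (x : n.-tuple R) i : (\int[lebesgue_measure]_y
    (normal_pdf y 1 (tnth x i) * h y)%:E = (D x i)%:E)%E.
  by rewrite fineK// (post_den_fin_num mq kap0 hE h1).
have mF i : measurable_fun setT (F (tnth a i)) by have [] := Fe (tnth a i).
have tF i x : expR (- (lam * tnth a i ^+ 2)) <= F (tnth a i) x.
  by have [_ + _ _ _] := Fe (tnth a i); exact.
have ND i x : N x i <= F (tnth a i) (tnth x i) * D x i.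
  by have [_ _ + _ _] := Fe (tnth a i); exact.
have eE i : (\int[lebesgue_measure]_x (F (tnth a i) x * normal_pdf (tnth a i) 1 x)%:E
    = (e (tnth a i))%:E)%E by have [] := Fe (tnth a i).
have ec i : e (tnth a i) <= expR (- (c * shrinkage alpha (tnth a i) ^+ 2)).
  by have [] := Fe (tnth a i).
have F0 i x : 0 <= F (tnth a i) x by rewrite (le_trans _ (tF i x))// expR_ge0.
have Fphi0 i x : 0 <= F (tnth a i) x * normal_pdf (tnth a i) 1 x.
  by rewrite mulr_ge0// normal_pdf_ge0.
have mFphi i :
    measurable_fun setT (fun x => F (tnth a i) x * normal_pdf (tnth a i) 1 x).
  by apply: measurable_funM => //; exact: measurable_normal_pdf.
have e0 i : 0 <= e (tnth a i).
  by rewrite -lee_fin -eE; apply: integral_ge0 => x _; rewrite lee_fin.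
rewrite unlock; set C := expR (lam * r ^+ 2).
apply: (@le_trans _ _ (\int[mvnormal a]_x
    (C * \prod_(i < n) F (tnth a i) (tnth x i))%:E)%E).
  (* This comparison does not ask for measurability of the posterior in [x]. *)
  apply: ge0_le_integralT => x; rewrite lee_fin; last first.
    exact: (posterior_ball_le w gE mh h0 (ltW lam0) r0 (NE x) (DE x)
      (fun i => ND i x) (fun i => tF i (tnth x i))).
  by rewrite divr_ge0// fine_ge0//; apply: integral_ge0 => t _;
    rewrite lee_fin gauss_pdf_ge0.
have mprod := measurable_prod_tnth mF.
rewrite ge0_integral_density_prob/=; last 2 first.
- by apply/measurable_EFinP; apply: measurable_funM.
- by move=> x; rewrite lee_fin mulr_ge0 ?expR_ge0 ?prodr_ge0.
rewrite (_ : integral _ _ _ = (C * \prod_(i < n) e (tnth a i))%:E); last first.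
  transitivity (\int[lebesgue_tuple n]_x (C%:E *
      (\prod_(i < n) (F (tnth a i) (tnth x i)
        * normal_pdf (tnth a i) 1 (tnth x i)))%:E))%E.
    apply: eq_integral => x _; rewrite -!EFinM; congr EFin.
    by rewrite big_split/= mulrA.
  rewrite ge0_integralZl//=.
  - by rewrite (ge0_integral_prod_tuple mFphi Fphi0 eE) -EFinM.
  - by apply/measurable_EFinP; exact: (measurable_prod_tnth mFphi).
  - by move=> x _; rewrite lee_fin prodr_ge0.
  - by rewrite lee_fin expR_ge0.
rewrite lee_fin expRD ler_wpM2l ?expR_ge0// mulr_sumr -sumrN expR_sum.
by apply: ler_prod => i _; rewrite e0 ec.
Qed.

End expected_posterior.

(** * Lower bounds in terms of the radii *)

Section radii.
Context {R : realType} {n : nat}.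
Implicit Types theta : n.-tuple R.

Let power_sum (alpha : R) theta (P : pred 'I_n) : R :=
  \sum_(i < n | P i) `|tnth theta i| `^ alpha.
Let square_sum theta (P : pred 'I_n) : R := \sum_(i < n | P i) tnth theta i ^+ 2.

Let square_sum_ge0 theta P : 0 <= square_sum theta P.
Proof. by apply: sumr_ge0 => i _; exact: sqr_ge0. Qed.

Let power_sum_ge0 alpha theta P : 0 <= power_sum alpha theta P.
Proof. by apply: sumr_ge0 => i _; exact: powR_ge0. Qed.

Let square_sum_le theta P : square_sum theta P <= square_sum theta xpredT.
Proof.
rewrite /square_sum [leRHS](bigID P)/= lerDl.
by apply: sumr_ge0 => i _; exact: sqr_ge0.
Qed.

Lemma l2norm_sq theta :
  l2norm (tnth theta) ^+ 2 = \sum_(i < n) tnth theta i ^+ 2.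
Proof. by rewrite sqr_sqrtr// sumr_ge0// => i _; exact: sqr_ge0. Qed.

(* Hölder's inequality up to a factor 2, from [u `^ alpha <= 1 + u ^+ 2]. *)
Let power_sum_le alpha theta P : 1 < alpha -> alpha < 2 ->
  power_sum alpha theta P <= 2 * (nnz theta)%:R *
    (Num.sqrt (square_sum theta P) / Num.sqrt (nnz theta)%:R) `^ alpha.
Proof.
move=> alpha1 alpha2; set m := square_sum theta P; set p := (nnz theta)%:R : R.
have m0 : 0 <= m := square_sum_ge0 theta P.
have p0 : 0 <= p by exact: ler0n.
have [mE|mn0] := eqVneq m 0.
  rewrite /power_sum big1 => [|i Pi]; first by rewrite !mulr_ge0 ?powR_ge0.
  have /eqP : tnth theta i ^+ 2 = 0.
    apply/eqP; rewrite eq_le sqr_ge0 andbT -[leRHS]mE /m /square_sum (bigD1 i)//=.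
    by rewrite lerDl sumr_ge0// => j _; exact: sqr_ge0.
  by rewrite sqrf_eq0 => /eqP->; rewrite normr0 powR0//; lra.
have m_gt0 : 0 < m by rewrite lt_neqAle eq_sym mn0.
have p_gt0 : 0 < p.
  rewrite ltr0n lt0n; apply: contra_neq mn0 => /= pE.
  apply: big1 => i _; apply/eqP; rewrite sqrf_eq0; apply: contraTT isT => ai.
  by have := card0_eq pE i; rewrite inE ai.
(* At this scale the rescaled squares sum to [p], the same as the bound on the count of nonzero
   terms; this balance produces the factor 2. *)
set t := Num.sqrt m / Num.sqrt p.
have t0 : 0 < t by rewrite divr_gt0// sqrtr_gt0.
have t2 : t ^+ 2 = m / p by rewrite expr_div_n !sqr_sqrtr.
have coord i : `|tnth theta i| `^ alpha <=
    t `^ alpha * ((tnth theta i != 0)%:R + tnth theta i ^+ 2 / t ^+ 2).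
  have [->|ai] := eqVneq (tnth theta i) 0.
    by rewrite normr0 powR0 ?expr0n/= ?mul0r ?addr0 ?mulr0//; lra.
  have -> : `|tnth theta i| = t * (`|tnth theta i| / t) by rewrite mulrC divfK// gt_eqF.
  rewrite powRM ?divr_ge0 ?(ltW t0)// ler_wpM2l ?powR_ge0//.
  rewrite -(real_normK (num_real (tnth theta i))) -expr_div_n.
  set u := `|_| / t; have u0 : 0 <= u by rewrite divr_ge0// ltW.
  have [u1|/ltW u1] := leP u 1.
    rewrite (@le_trans _ _ 1)//; last by rewrite lerDl sqr_ge0.
    apply: (@le_trans _ _ (1 `^ alpha)); last by rewrite powR1.
    by rewrite ge0_ler_powR ?nnegrE//; lra.
  rewrite (@le_trans _ _ (u ^+ 2))//; last by rewrite lerDr.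
  by rewrite -powR_mulrn// ler_powR// ltW.
apply: (le_trans (ler_sum _ (fun i _ => coord i))).
rewrite -mulr_sumr big_split/= -mulr_suml -/(square_sum theta P) -/m t2.
have -> : m / (m / p) = p by field; rewrite !gt_eqF.
rewrite mulrC ler_wpM2r ?powR_ge0//.
have : \sum_(i < n | P i) (tnth theta i != 0)%:R <= p.
  rewrite /p /nnz/= -sum1_card natr_sum big_mkcond [leRHS]big_mkcond/=.
  by apply: ler_sum => i _; rewrite inE; case: (P i); case: (_ != 0).
lra.
Qed.

(** This is the root of order [alpha] of [power_sum_le]: the powers of [p] combine to its square
    root, which cancels the one in [t]. *)
Let lpnorm_le alpha theta P k : 1 < alpha -> alpha < 2 -> 1 <= k ->
  power_sum alpha theta xpredT <= k * power_sum alpha theta P ->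
  lpnorm alpha (tnth theta) * (nnz theta)%:R `^ (2^-1 - alpha^-1)
    <= 2 * k * Num.sqrt (square_sum theta P).
Proof.
move=> alpha1 alpha2 k1 AP.
have ainv0 : 0 < alpha^-1 by rewrite invr_gt0; lra.
have ainv1 : alpha^-1 <= 1 by rewrite invf_le1; lra.
set p := (nnz theta)%:R : R; set m := square_sum theta P.
have [p0|p_gt0] := eqVneq p 0.
  (* Since [alpha < 2] the exponent is nonzero, so the power of 0 is 0 and not the conventional
     1. *)
  rewrite p0 powR0 ?mulr0; first by rewrite !mulr_ge0 ?sqrtr_ge0//; lra.
  rewrite subr_eq0; apply/eqP => h.
  by have := congr1 (fun x => x^-1) h; rewrite !invrK; lra.
have {}p_gt0 : 0 < p by rewrite lt_neqAle eq_sym p_gt0 ler0n.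
set t := Num.sqrt m / Num.sqrt p.
have t0 : 0 <= t by rewrite divr_ge0 ?sqrtr_ge0.
have At : power_sum alpha theta xpredT <= 2 * k * p * t `^ alpha.
  have := power_sum_le theta P alpha1 alpha2; rewrite -/p -/m -/t => Pt.
  apply: (le_trans AP).
  rewrite (_ : 2 * k * p * _ = k * (2 * p * t `^ alpha)); last by ring.
  by rewrite ler_wpM2l//; lra.
apply: (@le_trans _ _ ((2 * k * p * t `^ alpha) `^ alpha^-1 * p `^ (2^-1 - alpha^-1))).
  rewrite ler_wpM2r ?powR_ge0// ge0_ler_powR ?nnegrE ?power_sum_ge0//.
  - exact: ltW.
  - by rewrite !mulr_ge0 ?powR_ge0 ?ltW//; lra.
rewrite powRM ?powR_ge0//; last by rewrite !mulr_ge0 ?ltW//; lra.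
rewrite (@powRM _ (2 * k)) ?(ltW p_gt0)//; last by lra.
rewrite -powRrM mulfV ?powRr1//; last by lra.
have -> : (2 * k) `^ alpha^-1 * p `^ alpha^-1 * t * p `^ (2^-1 - alpha^-1)
    = (2 * k) `^ alpha^-1 * t * (p `^ alpha^-1 * p `^ (2^-1 - alpha^-1)) by ring.
rewrite -powRD; last by rewrite (gt_eqF p_gt0) implybT.
rewrite addrC subrK powR12_sqrt ?(ltW p_gt0)// -mulrA /t divfK; last first.
  by rewrite gt_eqF// sqrtr_gt0.
by rewrite ler_wpM2r ?sqrtr_ge0// ler1_powR//; lra.
Qed.

Let sq_le_sqrt (x k s : R) : 0 <= x -> 0 <= s -> x <= k * Num.sqrt s ->
  x ^+ 2 <= k ^+ 2 * s.
Proof.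
move=> x0 s0 xs; rewrite -[in leRHS](sqr_sqrtr s0) -exprMn.
by rewrite ler_pXn2r ?nnegrE// (le_trans x0).
Qed.

(** Coordinates are split at absolute value 1. If the small ones carry half of the power sum [A],
    they control [L], and their shrinkage is their absolute value. Otherwise the squared radius is
    at most 4 A^2/m, hence at most 16 B^2/m; each term of [B] is an absolute value times its
    shrinkage, so Cauchy-Schwarz gives B^2/m at most [W]. *)
Lemma rho_radius_sq_le alpha theta : 1 < alpha -> alpha < 2 ->
  rho_radius alpha theta ^+ 2
    <= 16 * \sum_(i < n) shrinkage alpha (tnth theta i) ^+ 2.
Proof.
move=> alpha1 alpha2; set W := \sum_(i < n) _.
pose small i := `|tnth theta i| <= 1.
set L := lpnorm alpha (tnth theta) * (nnz theta)%:R `^ (2^-1 - alpha^-1).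
set A := power_sum alpha theta xpredT; set m := square_sum theta xpredT.
have m0 : 0 <= m by exact: square_sum_ge0.
have A0 : 0 <= A by exact: power_sum_ge0.
have rhoE : rho_radius alpha theta = Num.min (A / m) 1 * L.
  rewrite /rho_radius l2norm_sq -mulrA; congr (Num.min (_ / _) _ * _).
  by rewrite /lpnorm -powRrM mulVf ?powRr1//; lra.
have L0 : 0 <= L by rewrite mulr_ge0 ?powR_ge0.
have min0 : 0 <= Num.min (A / m) 1 by rewrite le_min divr_ge0/=.
have Wsplit : W = \sum_(i < n | small i) shrinkage alpha (tnth theta i) ^+ 2
  + \sum_(i < n | ~~ small i) shrinkage alpha (tnth theta i) ^+ 2.
  by rewrite /W (bigID small).
have Asplit : A = power_sum alpha theta small + power_sum alpha theta (predC small).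
  by rewrite /A /power_sum (bigID small).
have W_ge0 Q : 0 <= \sum_(i < n | Q i) shrinkage alpha (tnth theta i) ^+ 2.
  by apply: sumr_ge0 => i _; exact: sqr_ge0.
rewrite rhoE; set S := power_sum alpha theta small in Asplit *.
set B := power_sum alpha theta (predC small) in Asplit *.
have [BS|SB] := leP B S.
  have LS : L <= 2 * 2 * Num.sqrt (square_sum theta small).
    have AS : A <= 2 * S by lra.
    by apply: (lpnorm_le alpha1 alpha2 _ AS); lra.
  have mW : square_sum theta small <= W.
    rewrite Wsplit -[leLHS]addr0 lerD//; apply: ler_sum => i smalli.
    by rewrite shrinkage_small// real_normK// num_real.
  have /sq_le_sqrt : Num.min (A / m) 1 * L
      <= 4 * Num.sqrt (square_sum theta small).
    rewrite -[leRHS]mul1r ler_pM// ?ge_min ?lexx ?orbT//.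
    by rewrite (le_trans LS)//; lra.
  by rewrite mulr_ge0// square_sum_ge0 => /(_ isT isT); lra.
have Lm : L <= 2 * 1 * Num.sqrt m.
  by apply: lpnorm_le => //; rewrite mul1r.
have : Num.min (A / m) 1 * L <= A / m * 2 * Num.sqrt m.
  by rewrite -mulrA ler_pM// ?ge_min ?lexx//; rewrite mulr1 in Lm.
move=> /sq_le_sqrt; rewrite mulr_ge0// m0 => /(_ isT isT) /le_trans; apply.
have [mE|mn0] := eqVneq m 0.
  by rewrite mE !mulr0 mulr_ge0// W_ge0.
have m_gt0 : 0 < m by rewrite lt_neqAle eq_sym mn0.
(* This value maximizes [2 * r * B - r ^+ 2 * m], with maximum B^2/m. *)
pose r := B / m.
have B0 : 0 <= B by exact: power_sum_ge0.
(* Cauchy-Schwarz: expand the sum of squares of [shrinkage - r * `|a|]. *)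
have CS : 2 * r * B - r ^+ 2 * m <= W.
  rewrite Wsplit -[leLHS]add0r lerD//.
  apply: (@le_trans _ _ (2 * r * B - r ^+ 2 * square_sum theta (predC small))).
    by rewrite lerB// ler_wpM2l ?sqr_ge0// square_sum_le.
  rewrite /B /power_sum /square_sum !mulr_sumr -sumrB; apply: ler_sum => i /= big.
  have a1 : 1 <= `|tnth theta i| by rewrite ltW// ltNge.
  have sE : `|tnth theta i| * shrinkage alpha (tnth theta i) = `|tnth theta i| `^ alpha.
    by rewrite shrinkage_large// (min_idPr _) ?mulr_powRB1//; lra.
  rewrite -sE -(real_normK (num_real (tnth theta i))).
  have := sqr_ge0 (shrinkage alpha (tnth theta i) - r * `|tnth theta i|).
  lra.
have rB : r * B = B ^+ 2 / m by rewrite /r; ring.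
have rm : r ^+ 2 * m = B ^+ 2 / m by rewrite /r; field.
have AB : A ^+ 2 <= (2 * B) ^+ 2.
  by rewrite ler_pXn2r ?nnegrE//; lra.
have -> : (A / m * 2) ^+ 2 * m = 4 * (A ^+ 2 / m) by field.
have : A ^+ 2 / m <= (2 * B) ^+ 2 / m by rewrite ler_wpM2r// invr_ge0.
have -> : (2 * B) ^+ 2 / m = 4 * (B ^+ 2 / m) by field.
lra.
Qed.

(** From ln(n/p) >= 1 - p/n the rate is at least p(n - p)/n, which is at least (n - 1)/n for p
    between 1 and n - 1. *)
Lemma sparse_rate_ge theta : (1 < n)%N -> (1 <= nnz theta < n)%N ->
  1 / 2 <= sparse_rate theta.
Proof.
move=> n1 /andP[p1 pn]; rewrite /sparse_rate.
set p : R := (nnz theta)%:R.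
have p_ge1 : 1 <= p by rewrite ler1n.
have pn1 : p + 1 <= n%:R by rewrite natr1 ler_nat.
have n2 : 2 <= n%:R :> R by rewrite ler_nat.
have lnge : 1 - p / n%:R <= ln (n%:R / p).
  have -> : n%:R / p = (p / n%:R)^-1 by rewrite invf_div.
  have pn0 : 0 < p / n%:R by rewrite divr_gt0; lra.
  have := @le_ln1Dx R (p / n%:R - 1); rewrite [1 + _]addrC subrK lnV ?posrE//.
  by move=> /(_ ltac:(lra)); lra.
apply: (@le_trans _ _ (p * (1 - p / n%:R))); last by rewrite ler_wpM2l//; lra.
have -> : p * (1 - p / n%:R) = (p * (n%:R - p)) / n%:R by field; lra.
by rewrite ler_pdivlMr; [nra|lra].
Qed.

End radii.

(** * Passage to the limit *)

Section posterior_limit.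
Context {R : realType}.

Lemma cvg_expR_oppr (k : R) (u : nat -> R) : 0 < k ->
  u n @[n --> \oo] --> +oo -> expR (- (k * u n)) @[n --> \oo] --> (0 : R).
Proof.
move=> k0 uoo; apply: (cvg_comp u (fun x => expR (- (k * x))) uoo).
have koo : k * x @[x --> +oo] --> +oo by apply: gt0_cvgMry => //; exact: cvg_id.
exact: (cvg_comp (GRing.mul k) _ koo (@cvgr_expR R)).
Qed.

Lemma cvge0_of_expR_bound (E : nat -> \bar R) (k : R) (u : nat -> R) : 0 < k ->
  u n @[n --> \oo] --> +oo ->
  (\forall n \near \oo, (0 <= E n <= (expR (- (k * u n)))%:E)%E) ->
  E n @[n --> \oo] --> 0%E.
Proof.
move=> k0 uoo EP; apply: (squeeze_cvge EP); first exact: cvg_cst.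
by apply: cvg_EFin; [exact: nearW|exact: cvg_expR_oppr].
Qed.

(** Both regimes of [alpha] reduce to this: all that matters about the radius is that its square is
    at most 16 times the sum of squared shrinkages. *)
Lemma posterior_ball_cvg0 (theta0 : forall n : nat, n.-tuple R)
    (alpha : R) (pi_ : forall n : nat, fin_pmf R 'I_n.+1)
    (g : forall (n : nat) (S : {set 'I_n}), density R #|S|) (rad : nat -> R) :
  (forall n : nat, (1 < n)%N -> (1 <= nnz (theta0 n) < n)%N) -> 1 < alpha ->
  (forall (n : nat) (S : {set 'I_n}) (y : #|S|.-tuple R),
    g n S y = \prod_(i < #|S|) exp_power_pdf alpha (tnth y i)) ->
  (forall n, 0 <= rad n) ->
  (forall n, rad n ^+ 2 <=
    16 * \sum_(i < n) shrinkage alpha (tnth (theta0 n) i) ^+ 2) ->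
  (rad n ^+ 2 / sparse_rate (theta0 n)) @[n --> \oo] --> +oo ->
  exists2 eta0 : R, 0 < eta0 & forall eta : R, 0 < eta < eta0 ->
    ('E_(mvnormal (theta0 n))[(fun x =>
       posterior (prior (pi_ n) (g n)) x
         [set theta : n.-tuple R | l2norm (fun i => tnth theta i - tnth (theta0 n) i)
                                   <= eta * rad n])%R])%E
      @[n --> \oo] --> 0%E.
Proof.
move=> p_bounds alpha1 gE rad0 radW radoo.
pose kap := (\int[lebesgue_measure]_z expR (- (`|z| `^ alpha)))^-1 : R.
have kap0 : 0 <= kap.
  by rewrite invr_ge0 fine_ge0// integral_ge0// => z _; rewrite lee_fin expR_ge0.
have hE y : exp_power_pdf alpha y = kap * expR (- `|y| `^ alpha) by rewrite mulrC.
have h0 y : 0 <= exp_power_pdf alpha y by rewrite hE mulr_ge0 ?expR_ge0.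
have mh : measurable_fun setT (exp_power_pdf alpha).
  rewrite (_ : exp_power_pdf alpha = fun y => kap * expR (- `|y| `^ alpha));
    last exact/funext.
  apply: measurable_funM => //.
  apply: measurableT_comp => //; apply: measurableT_comp => //.
  exact: (measurableT_comp (measurable_powR alpha)).
have h1 : (\int[lebesgue_measure]_y (exp_power_pdf alpha y)%:E = 1)%E.
  (* In dimension 1 with full support the prior density is the univariate one. *)
  apply: (integral_density1 _ (gE 1%N finset.setT) mh h0).
  by rewrite cardsT card_ord.
have [lam [c [lam0 c0 EP]]] := expectation_posterior_ball_le alpha1 kap0 hE h1.
(* Below this threshold the cost of the ball is at most c/32 times the squared radius, half of the
   gain c/16. *)
exists (Num.sqrt (c / (32 * lam))).
  by rewrite sqrtr_gt0 divr_gt0// mulr_gt0.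
move=> eta /andP[eta0 etas].
have eta2 : lam * eta ^+ 2 <= c / 32.
  have : eta ^+ 2 <= Num.sqrt (c / (32 * lam)) ^+ 2.
    by rewrite ler_pXn2r ?nnegrE ?sqrtr_ge0 ?ltW.
  rewrite sqr_sqrtr; last by rewrite divr_ge0 ?mulr_ge0 ?(ltW lam0) ?(ltW c0).
  move=> le.
  rewrite (_ : c / 32 = lam * (c / (32 * lam))); last by field; rewrite gt_eqF.
  by rewrite ler_wpM2l// ltW.
(* The net exponent is at most -c/32 times the squared radius, and a rate of at least 1/2 makes the
   squared radius at least half of the divergent ratio. *)
apply: (cvge0_of_expR_bound (k := c / 64) _ radoo); first by lra.
near=> n.
have n1 : (1 < n)%N by near: n; exact: nbhs_infty_gt.
apply/andP; split.
  rewrite unlock; apply: integral_ge0 => x _; rewrite lee_fin divr_ge0//;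
    by rewrite fine_ge0// integral_ge0// => t _; rewrite lee_fin gauss_pdf_ge0.
apply: (le_trans (EP n (pi_ n) (g n) (theta0 n) (eta * rad n) (gE n) _)).
  by rewrite mulr_ge0// ltW.
rewrite lee_fin ler_expR.
have rate := sparse_rate_ge n1 (p_bounds n n1).
set rt := sparse_rate _ in rate *; set W := \sum_(i < n) _.
have WP : rad n ^+ 2 <= 16 * W by exact: radW.
have : rad n ^+ 2 / rt <= 2 * rad n ^+ 2.
  rewrite ler_pdivrMr; last by lra.
  by have := sqr_ge0 (rad n); nra.
have : lam * (eta * rad n) ^+ 2 <= c / 32 * rad n ^+ 2.
  by rewrite exprMn mulrA ler_wpM2r// sqr_ge0.
move: (rad n ^+ 2) WP (rad n ^+ 2 / rt) => s WP v le1 le2.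
nra.
Unshelve. all: by end_near. Qed.

End posterior_limit.

Theorem theorem2p8 (R : realType) (theta0 : forall n : nat, n.-tuple R)
  (alpha c K : R)
  (pi_ : forall n : nat, fin_pmf R 'I_n.+1)
  (g : forall (n : nat) (S : {set 'I_n}), density R #|S|)
  (p_bounds : forall n : nat, (1 < n)%N -> (1 <= nnz (theta0 n) < n)%N)
  (alpha_gt1 : 1 < alpha) (c_gt0 : 0 < c) (K_gt0 : 0 < K)
  (pi_gt0 : forall (n : nat) (p : 'I_n.+1), 0 < pi_ n p)
  (g_prod : forall (n : nat) (S : {set 'I_n}) (y : #|S|.-tuple R),
    g n S y = \prod_(i < #|S|) exp_power_pdf alpha (tnth y i))
  (pi_lb : forall n : nat, (1 < n)%N ->
    K * expR (- (c * sparse_rate (theta0 n))) <= pi_ n (nnz (theta0 n))) :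
  (2 <= alpha ->
    (l2norm (tnth (theta0 n)) ^+ 2 / sparse_rate (theta0 n))
      @[n --> \oo] --> +oo ->
    exists2 eta0 : R, 0 < eta0 & forall eta : R, 0 < eta < eta0 ->
      ('E_(mvnormal (theta0 n))[(fun x =>
         posterior (prior (pi_ n) (g n)) x
           [set theta : n.-tuple R | l2norm (fun i => tnth theta i - tnth (theta0 n) i)
                                     <= eta * l2norm (tnth (theta0 n))])%R])%E
        @[n --> \oo] --> 0%E)
  /\
  (alpha < 2 ->
    (rho_radius alpha (theta0 n) ^+ 2 / sparse_rate (theta0 n))
      @[n --> \oo] --> +oo ->
    exists2 eta0 : R, 0 < eta0 & forall eta : R, 0 < eta < eta0 ->
      ('E_(mvnormal (theta0 n))[(fun x =>
         posterior (prior (pi_ n) (g n)) x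
           [set theta : n.-tuple R | l2norm (fun i => tnth theta i - tnth (theta0 n) i)
                                     <= eta * rho_radius alpha (theta0 n)])%R])%E
        @[n --> \oo] --> 0%E).
Proof.
split=> [alpha2|alpha2] ratio.
  apply: (@posterior_ball_cvg0 _ _ _ _ _ (fun n => l2norm (tnth (theta0 n)))
    p_bounds alpha_gt1 g_prod _ _ ratio).
  - by move=> n; exact: sqrtr_ge0.
  - move=> n; rewrite l2norm_sq.
    have -> : \sum_(i < n) tnth (theta0 n) i ^+ 2 =
        \sum_(i < n) shrinkage alpha (tnth (theta0 n) i) ^+ 2.
      by apply: eq_bigr => i _; rewrite shrinkage_ge_norm// real_normK// num_real.
    have : 0 <= \sum_(i < n) shrinkage alpha (tnth (theta0 n) i) ^+ 2.
      by apply: sumr_ge0 => i _; exact: sqr_ge0.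
    lra.
apply: (@posterior_ball_cvg0 _ _ _ _ _ (fun n => rho_radius alpha (theta0 n))
    p_bounds alpha_gt1 g_prod _ _ ratio).
- move=> n; rewrite /rho_radius !mulr_ge0 ?powR_ge0// le_min ler01 andbT.
  by rewrite divr_ge0 ?powR_ge0 ?sqr_ge0.
- by move=> n; exact: rho_radius_sq_le.
Qed.
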